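(* Let $k,\ell\in\mathbb{Z}_{>0}$, $s\in\{0,\dotsc,\lfloor k/2\rfloor\}$, $t\in\{0,\dotsc,\lfloor \ell/2\rfloor\}$ and $n\in\mathbb{Z}_{\geq 0}$. For holomorphic functions $f,g$ on $\mathcal{H}$ define \[ \Phi_{n;k,s;\ell,t}(f,g)\coloneqq\sum_{r=0}^n(-1)^r\binom{k-s+n-1}{n-r}\binom{\ell-t+n-1}{r}D^{r}f\,D^{n-r}g. \] Then $\Phi_{n;k,s;\ell,t}(f,g)\in M_{k+\ell+2n}^{\leq s+t}$ for all $f\in M_k^{\leq s}$ and $g\in M_\ell^{\leq t}$.
   Context: $\mathcal{H}$ is the complex upper half-plane and $D\coloneqq\frac{1}{2\pi i}\frac{d}{dz}$. For $\gamma=\begin{pmatrix} a&b\\ c&d\end{pmatrix}\in\mathrm{SL}(2,\mathbb{Z})$ put $X(\gamma)(z)=\frac{c}{cz+d}$ and $(f|_k\gamma)(z)=(cz+d)^{-k}f(\gamma z)$. For integers $k,s\ge 0$, $M_k^{\leq s}$ denotes the complex vector space of holomorphic $f:\mathcal{H}\to\mathbb{C}$ for which there exist holomorphic functions $Q_0(f),\dots,Q_s(f)$ on $\mathcal{H}$ with $f|_k\gamma=\sum_{i=0}^sQ_i(f)X(\gamma)^i$ for all $\gamma\in\mathrm{SL}(2,\mathbb{Z})$, and whose Fourier expansion (in $e^{2\pi i z}$) has no negative-index terms (quasimodular forms of weight $k$ and depth at most $s$ on $\mathrm{SL}(2,\mathbb{Z})$). By convention $M_k^{\le s}=\{0\}$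 for $k<0$ and $M_k^{\leq s}=M_k^{\leq \lfloor k/2\rfloor}$ for $s>k/2$. *)

(* Defs.v *)
From HB Require Import structures.
From mathcomp Require Import all_boot all_order all_algebra.
From mathcomp Require Import all_classical all_reals all_analysis.
From mathcomp Require Import complex.

Set Implicit Arguments.
Unset Strict Implicit.
Unset Printing Implicit Defensive.

Import Order.TTheory GRing.Theory Num.Theory.
Import numFieldNormedType.Exports.

Local Open Scope classical_set_scope.
Local Open Scope ring_scope.
Local Open Scope complex_scope.

(* [R[i]^o] is the complex field as a normed module over itself, so [derivable]
   and [derive1] are complex differentiability and the complex derivative.
   Functions on the upper half-plane are total functions of which only the
   values on [upper_half_plane] matter; that set is open, so these values
   determine all derivatives there. *)
Section QuasimodularForms.
Variable R : realType.
Local Notation C := (R[i]^o).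
Implicit Types (f g : C -> C) (gamma : 'M[int]_2) (z : C).

Definition upper_half_plane : set C := [set z | 0 < complex.Im z].

Definition holomorphic f : Prop :=
  forall z, upper_half_plane z -> derivable f z 1.

Definition two_pi_i : C := 0 +i* (2 * pi).

Definition D f : C -> C := fun z => two_pi_i^-1 * derive1 f z.

Definition cexp z : C :=
  (expR (complex.Re z))%:C * (cos (complex.Im z) +i* sin (complex.Im z)).

Definition nome z : C := cexp (two_pi_i * z).

Definition autJ gamma z : C := (gamma 1 0)%:~R * z + (gamma 1 1)%:~R.

Definition moebius gamma z : C :=
  ((gamma 0 0)%:~R * z + (gamma 0 1)%:~R) / autJ gamma z.

Definition slash (k : nat) f gamma : C -> C :=
  fun z => autJ gamma z ^- k * f (moebius gamma z).

Definition X gamma z : C := (gamma 1 0)%:~R / autJ gamma z.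

Definition quasi_transform (k s : nat) f : Prop :=
  exists Q : 'I_s.+1 -> C -> C,
    (forall i, holomorphic (Q i)) /\
    forall gamma, \det gamma = 1 -> forall z, upper_half_plane z ->
      slash k f gamma z = \sum_(i < s.+1) Q i z * X gamma z ^+ i.

(* The transformation law forces [f (z + 1) = f z], so [f] has a Fourier
   expansion over all integer indices; this says that only indices [n >= 0]
   occur. *)
Definition fourier_nonneg f : Prop :=
  exists a : nat -> C, forall z, upper_half_plane z ->
    series (fun n => a n * nome z ^+ n) @ \oo --> f z.

(* The depth is capped at [k./2], following the convention that the space for
   [s > k / 2] is the one for [s = k./2]. *)
Definition quasimodular (k s : nat) f : Prop :=
  [/\ holomorphic f, quasi_transform k (minn s k./2) f & fourier_nonneg f].

(* The natural-number subtractions are exact as soon as [s < k] and [t < l]. *)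
Definition Phi (n k s l t : nat) f g : C -> C := fun z =>
  \sum_(r < n.+1)
    (-1) ^+ r * 'C(k - s + n - 1, n - r)%:R * 'C(l - t + n - 1, r)%:R
    * iter r D f z * iter (n - r) D g z.

End QuasimodularForms.

(* Main.v *)
Require Import Defs.
From mathcomp Require Import all_boot all_order all_algebra.
From mathcomp Require Import all_classical all_reals all_analysis.
From mathcomp Require Import complex ring lra zify.

(* Put X = c / (c z + d) and Y = X / (2 pi i), so that D Y = - Y ^ 2.  The
   slashed derivatives F_r = (D^r f)|_{k+2r} gamma satisfy
   F_{r+1} = D F_r + (k + 2 r) Y F_r, whence, from F_0 = sum_i Q_i Y^i,
     F_r = sum_i sum_(a <= r) C(r,a) (k-i+r-1)^_(r-a) Y^(i+r-a) D^a Q_i.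
   Inserted in the bracket, this gives a polynomial in Y in which the monomial
   D^a Q_i(f) D^b Q_j(g) comes with Y^(i+j+n-a-b).  Writing i = s - u and
   j = t - v, its coefficient is a multiple of an alternating binomial sum of
   order n - a - b of a polynomial of degree u + v, hence vanishes as soon as
   i + j + n - a - b > s + t: the depth is at most s + t.

   All the analysis rests on the Fourier expansion.  Its coefficients a_n are
   such that a_n r^n is bounded for every r < 1; this condition is preserved by
   a_n -> n a_n and by Cauchy products, and it allows termwise differentiation.
   So f and g are infinitely differentiable and the bracket has a Fourier
   expansion with nonnegative indices, without any appeal to Cauchy's theory. *)

Set Implicit Arguments.
Unset Strict Implicit.
Unset Printing Implicit Defensive.
Import Order.TTheory GRing.Theory Num.Theory.
Import numFieldNormedType.Exports.
Local Open Scope classical_set_scope.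
Local Open Scope ring_scope.
Local Open Scope complex_scope.

(** * Finite differences and the algebra of the bracket *)

Lemma coef_comp_polyXaddC1 (K : comNzRingType) (p : {poly K}) N m :
  (size p <= N)%N ->
  (p \Po ('X + 1))`_m = \sum_(i < N) p`_i * 'C(i, m)%:R.
Proof.
move=> le_pN; rewrite comp_polyE coef_sum.
rewrite (big_ord_widen N (fun i => (p`_i *: ('X + 1) ^+ i)`_m)) // big_mkcond /=.
apply: eq_bigr => i _; case: ltnP => [_ | le_pi]; last first.
  by rewrite nth_default // mul0r.
rewrite coefZ exprD1n coef_sum; congr (_ * _).
have [le_mi | lt_im] := leqP m i.
  rewrite (bigD1 (Ordinal (le_mi : m < i.+1)%N)) //= coefMn coefXn eqxx.
  rewrite big1 ?addr0 // => j; rewrite -val_eqE /= => ne_jm.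
  by rewrite coefMn coefXn eq_sym (negPf ne_jm) mul0rn.
rewrite bin_small // big1 // => j _; rewrite coefMn coefXn.
by case: eqP => [mj|_]; rewrite ?mul0rn //; have := ltn_ord j; lia.
Qed.

(** Pascal's rule splits ['C(N.+1, j)] in two; the part with ['C(N, j)] gives [u j], and the shifted
    part gives [- u j.+1]. *)
Lemma finite_difference_step (K : comNzRingType) N (u : nat -> K) :
  \sum_(j < N.+2) (-1) ^+ j * 'C(N.+1, j)%:R * u j
    = \sum_(j < N.+1) (-1) ^+ j * 'C(N, j)%:R * (u j - u j.+1).
Proof.
under [RHS]eq_bigr do rewrite mulrBr.
rewrite sumrB big_ord_recl /=.
under eq_bigr => j _ do rewrite /= /bump /= add1n binS natrD mulrDr mulrDl.
rewrite big_split /= addrA; congr (_ + _).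
  transitivity (\sum_(j < N.+2) (-1) ^+ j * 'C(N, j)%:R * u j).
    by rewrite [RHS]big_ord_recl /= !bin0.
  by rewrite big_ord_recr /= bin_small // mulr0 mul0r addr0.
by rewrite -sumrN; apply: eq_bigr => j _; rewrite exprS; ring.
Qed.

(** Passing from p to q = p - p(X + 1) lowers the degree, with new top coefficient -(N + 1) p_(N+1);
    induction on N then produces the factorial. The lemma serves twice: it vanishes for low degree,
    and it extracts a top coefficient in [smooth_coeffs]. *)
Lemma finite_difference_horner (K : comNzRingType) N (p : {poly K}) :
  (size p <= N.+1)%N ->
  \sum_(j < N.+1) (-1) ^+ j * 'C(N, j)%:R * p.[j%:R]
    = (-1) ^+ N * N`!%:R * p`_N.
Proof.
elim: N p => [|N IHN] p le_p.
  by rewrite big_ord1 /= bin0 fact0 horner_coef0.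
pose q := p - (p \Po ('X + 1)).
have qE m : q`_m = p`_m - \sum_(i < N.+2) p`_i * 'C(i, m)%:R.
  by rewrite /q coefB (coef_comp_polyXaddC1 _ le_p).
have le_q : (size q <= N.+1)%N.
  apply/leq_sizeP => m lt_Nm; rewrite qE big_ord_recr /= big1 ?add0r; last first.
    by move=> i _; rewrite bin_small ?mulr0 // (leq_trans (ltn_ord i)).
  have [-> | ne_mN] := eqVneq m N.+1; first by rewrite binn mulr1 subrr.
  have lt_N1m : (N.+1 < m)%N by lia.
  by rewrite bin_small // mulr0 subr0 nth_default // (leq_trans le_p).
have q_N : q`_N = - (N.+1%:R * p`_N.+1).
  rewrite qE !big_ord_recr /= big1 ?add0r; last first.
    by move=> i _; rewrite bin_small ?mulr0.
  by rewrite binn binSn; ring.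
rewrite (finite_difference_step N (fun j => p.[j%:R])).
transitivity (\sum_(j < N.+1) (-1) ^+ j * 'C(N, j)%:R * q.[j%:R]).
  by apply: eq_bigr => j _; rewrite hornerD hornerN horner_comp !hornerE natr1.
by rewrite IHN // q_N factS natrM exprS; ring.
Qed.

Lemma natr_fact_neq0 (K : numFieldType) m : m`!%:R != 0 :> K.
Proof. by rewrite pnatr_eq0 -lt0n fact_gt0. Qed.

Lemma natr_bin_fact (K : numFieldType) m k : (k <= m)%N ->
  'C(m, k)%:R = m`!%:R / (k`!%:R * (m - k)`!%:R) :> K.
Proof.
move=> le_km; rewrite -(bin_fact le_km) !natrM.
by rewrite mulfK ?mulf_neq0 ?natr_fact_neq0.
Qed.

Lemma natr_ffact_fact (K : numFieldType) m k : (k <= m)%N ->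
  (m ^_ k)%:R = m`!%:R / (m - k)`!%:R :> K.
Proof.
by move=> le_km; rewrite -(ffact_fact le_km) natrM mulfK ?natr_fact_neq0.
Qed.

(** With x = c + e j, the falling factorial is a product of u factors affine in j; the bound u <= x
    keeps each difference x - i exact in the natural numbers. *)
Lemma ffact_poly (K : comNzRingType) (e : K) c u :
  exists2 p : {poly K}, (size p <= u.+1)%N &
    forall j x, c%:R + e * j%:R = x%:R -> (u <= x)%N -> p.[j%:R] = (x ^_ u)%:R.
Proof.
pose F (i : nat) : {poly K} := e *: 'X + (c%:R - i%:R)%:P.
exists (\prod_(i < u) F i).
  have le2 (i : 'I_u) : (size (F i) <= 2)%N.
    rewrite (leq_trans (size_polyD _ _)) // geq_max.
    rewrite (leq_trans (size_scale_leq _ _)) ?size_polyX //.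
    by rewrite (leq_trans (size_polyC_leq1 _)).
  apply: leq_trans (size_poly_prod_leq _ _) _.
  have : (\sum_(i < u) size (F i) <= \sum_(i < u) 2)%N by apply: leq_sum.
  rewrite sum_nat_const !card_ord => le_sum.
  by rewrite leq_subLR addnS ltnS (leq_trans le_sum) // muln2 addnn.
move=> j x xE le_ux; rewrite horner_prod ffact_prod natr_prod.
apply: eq_bigr => i _; rewrite /F !hornerE natrB -?xE ?[c%:R + _]addrC //.
by rewrite (leq_trans _ le_ux) // ltnW.
Qed.

(** This is the summand at r = a + j, n - r = b + i, with every binomial written in factorials. For
    fixed m = i + j, the multipliers on both sides do not depend on j, so the summand is
    proportional to C(m, j) times two falling factorials of fixed orders u and v. *)
Lemma rankin_cohen_term (K : numFieldType) k l u v a b i j :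
  ((j + i)`! * a`! * (k + u + a)`! * b`! * (l + v + b)`!)%:R *
  ('C(k + (a + j + (b + i)), b + i)%:R * 'C(l + (a + j + (b + i)), a + j)%:R *
   ('C(a + j, a)%:R * ((k + u + (a + j)) ^_ j)%:R) *
   ('C(b + i, b)%:R * ((l + v + (b + i)) ^_ i)%:R))
  = ((k + (a + j + (b + i)))`! * (l + (a + j + (b + i)))`!)%:R *
    ('C(j + i, j)%:R * (((k + u + (a + j)) ^_ u)%:R *
                        ((l + v + (b + i)) ^_ v)%:R)) :> K.
Proof.
rewrite !natr_bin_fact ?natr_ffact_fact; try lia.
have -> : (k + (a + j + (b + i)) - (b + i) = k + (a + j))%N by lia.
have -> : (l + (a + j + (b + i)) - (a + j) = l + (b + i))%N by lia.
have -> : (a + j - a = j)%N by lia.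
have -> : (b + i - b = i)%N by lia.
have -> : (j + i - j = i)%N by lia.
have -> : (k + u + (a + j) - j = k + u + a)%N by lia.
have -> : (k + u + (a + j) - u = k + (a + j))%N by lia.
have -> : (l + v + (b + i) - i = l + v + b)%N by lia.
have -> : (l + v + (b + i) - v = l + (b + i))%N by lia.
rewrite !natrM; field.
by rewrite !natr_fact_neq0.
Qed.

(** After [rankin_cohen_term] the sum is an alternating binomial sum of order m = n - a - b of a
    polynomial of degree at most u + v < m. *)
Lemma rankin_cohen_vanish (K : numFieldType) n k l u v a b :
  (u + v + a + b < n)%N ->
  \sum_(r < n.+1) (-1) ^+ r * 'C(k + n, n - r)%:R * 'C(l + n, r)%:R *
    ('C(r, a)%:R * ((k + u + r) ^_ (r - a))%:R) *
    ('C(n - r, b)%:R * ((l + v + (n - r)) ^_ (n - r - b))%:R) = 0 :> K.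
Proof.
move=> lt_n; pose m := (n - a - b)%N.
have nE : n = (a + m + b)%N by rewrite /m; lia.
pose T r : K := (-1) ^+ r * 'C(k + n, n - r)%:R * 'C(l + n, r)%:R *
    ('C(r, a)%:R * ((k + u + r) ^_ (r - a))%:R) *
    ('C(n - r, b)%:R * ((l + v + (n - r)) ^_ (n - r - b))%:R).
(* ['C(r, a)] kills r < a and ['C(n - r, b)] kills r > a + m, which leaves m + 1 terms r = a + j. *)
rewrite -(big_mkord predT T) (@big_cat_nat _ _ _ a) //=; last by lia.
rewrite big_nat big1 ?add0r; last first.
  by move=> r /andP[_ lt_ra]; rewrite /T (bin_small lt_ra) !(mul0r, mulr0).
rewrite (@big_cat_nat _ _ _ (a + m).+1) //=; [|lia|lia].
rewrite [X in _ + X]big_nat [X in _ + X]big1 ?addr0; last first.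
  move=> r /andP[lt_r lt_rn].
  by rewrite /T ['C(n - r, b)]bin_small ?(mul0r, mulr0) //; lia.
rewrite -{1}[a]add0n big_addn (_ : (a + m).+1 - a = m.+1)%N; last by lia.
rewrite big_mkord.
(* The first argument k + u + a + j increases with j, while the second, l + v + b + m - j,
   decreases: hence the slopes 1 and -1. *)
have [p le_p pE] := ffact_poly (1 : K) (k + u + a) u.
have [q le_q qE] := ffact_poly (-1 : K) (l + v + b + m) v.
pose c : K := (m`! * a`! * (k + u + a)`! * b`! * (l + v + b)`!)%:R.
have c_neq0 : c != 0 by rewrite /c !natrM !mulf_neq0 ?natr_fact_neq0.
apply: (mulfI c_neq0); rewrite mulr0 mulr_sumr.
transitivity ((-1) ^+ a * ((k + n)`! * (l + n)`!)%:R *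
    \sum_(j < m.+1) (-1) ^+ j * 'C(m, j)%:R * (p * q).[j%:R]); last first.
  rewrite finite_difference_horner; last first.
    by rewrite (leq_trans (size_polyMleq _ _)) //; lia.
  rewrite nth_default ?mulr0 //.
  by rewrite (leq_trans (size_polyMleq _ _)) //; lia.
rewrite mulr_sumr; apply: eq_bigr => j _.
have lt_jm := ltn_ord j; pose i := (m - j)%N.
rewrite hornerM (pE _ (k + u + (a + j))%N); [|by rewrite mul1r -natrD addnA|lia].
rewrite (qE _ (l + v + (b + i))%N); [|by rewrite mulN1r -natrB /i; [congr _%:R|]; lia|lia].
have := @rankin_cohen_term K k l u v a b i j.
have -> : (a + j + (b + i) = n)%N by rewrite /i; lia.
have mE : (j + i = m)%N by rewrite /i; lia.
rewrite mE -/c /T (addnC j a).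
have -> : (n - (a + j) = b + i)%N by rewrite /i; lia.
have -> : (a + j - a = j)%N by lia.
have -> : (b + i - b = i)%N by lia.
rewrite exprD => eqT.
transitivity ((-1) ^+ a * (-1) ^+ j * (c *
  ('C(k + n, b + i)%:R * 'C(l + n, a + j)%:R *
   ('C(a + j, a)%:R * ((k + u + (a + j)) ^_ j)%:R) *
   ('C(b + i, b)%:R * ((l + v + (b + i)) ^_ i)%:R)))); first by ring.
by rewrite eqT; ring.
Qed.

(** * Slashed derivatives and their bracket as polynomials in Y *)

Definition depth_term (K : numFieldType) k (i a r : nat) : K :=
  'C(r, a)%:R * ((k - i + r - 1) ^_ (r - a))%:R.

(** The slashed derivative F_r at one point: [A i a] stands for the value of D^a Q_i and [y] for
    that of Y, so that the algebra is free of functions. *)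
Definition depth_expansion (K : numFieldType) k s (A : nat -> nat -> K) y r :=
  \sum_(i < s.+1) \sum_(a < r.+1) depth_term K k i a r * A i a * y ^+ (i + (r - a)).

Definition bracket_coef (K : numFieldType) n k s l t r : K :=
  (-1) ^+ r * 'C(k - s + n - 1, n - r)%:R * 'C(l - t + n - 1, r)%:R.

Definition bracket_weight (K : numFieldType) n k s l t i i' a b : K :=
  \sum_(r < n.+1) bracket_coef K n k s l t r *
    depth_term K k i a r * depth_term K l i' b (n - r).

(** The coefficient of Y^p in the bracket. The condition means p = i + i' + n - a - b, written
    without truncated subtraction. *)
Definition bracket_component (K : numFieldType) n k s l t
    (A B : nat -> nat -> K) (p : nat) : K :=
  \sum_(x : 'I_s.+1 * 'I_n.+1) \sum_(x' : 'I_t.+1 * 'I_n.+1)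
    if (x.1 + x'.1 + n == p + x.2 + x'.2)%N
    then bracket_weight K n k s l t x.1 x'.1 x.2 x'.2 * (A x.1 x.2 * B x'.1 x'.2)
    else 0.

(** Terms with a > r vanish because ['C(r, a)] does. The index range no longer depends on r, so it
    can be exchanged with the sum over r. *)
Lemma depth_expansion_widen (K : numFieldType) k s (A : nat -> nat -> K) y r n :
  (r <= n)%N -> depth_expansion k s A y r =
  \sum_(x : 'I_s.+1 * 'I_n.+1)
     depth_term K k x.1 x.2 r * A x.1 x.2 * y ^+ (x.1 + (r - x.2)).
Proof.
move=> le_rn; pose F (i a : nat) := depth_term K k i a r * A i a * y ^+ (i + (r - a)).
rewrite -(pair_bigA _ (fun (i : 'I_s.+1) (a : 'I_n.+1) => F i a)) /=.
apply: eq_bigr => i _.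
rewrite (big_ord_widen n.+1 (F i)) ?ltnS // big_mkcond; apply: eq_bigr => a _.
by case: ltnP => // lt_ra; rewrite /F /depth_term bin_small // !mul0r.
Qed.

Lemma bracket_depth (K : numFieldType) n k s l t (A B : nat -> nat -> K) y :
  (s < k)%N -> (t < l)%N ->
  \sum_(r < n.+1) bracket_coef K n k s l t r *
     depth_expansion k s A y r * depth_expansion l t B y (n - r)
  = \sum_(p < (s + t).+1) bracket_component n k s l t A B p * y ^+ p.
Proof.
move=> lt_sk lt_tl.
under eq_bigr => r _.
  have le_rn : (r <= n)%N by rewrite -ltnS.
  rewrite (depth_expansion_widen _ _ _ _ le_rn).
  rewrite (depth_expansion_widen _ _ _ _ (leq_subr r n)).
  rewrite -mulrA big_distrlr mulr_sumr /=.
  under eq_bigr do rewrite mulr_sumr.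
  over.
rewrite exchange_big /=; under eq_bigr do rewrite exchange_big /=.
under [RHS]eq_bigr do rewrite mulr_suml.
rewrite [RHS]exchange_big /=; apply: eq_bigr => -[i a] _ /=.
under [RHS]eq_bigr do rewrite mulr_suml.
rewrite [RHS]exchange_big /=; apply: eq_bigr => -[i' b] _ /=.
have [lt_is lt_it] := (ltn_ord i, ltn_ord i').
pose w := bracket_weight K n k s l t i i' a b.
(* For fixed (i, a) and (i', b) the exponent (i + r - a) + (i' + n - r - b) does not depend on r, so
   y factors out of the sum. *)
transitivity (w * (A i a * B i' b) * y ^+ (i + i' + n - a - b)).
  rewrite /w mulr_suml mulr_suml; apply: eq_bigr => r _.
  have lt_rn := ltn_ord r.
  have [lt_ra | le_ar] := ltnP r a.
    by rewrite /depth_term (bin_small lt_ra) !(mul0r, mulr0).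
  have [lt_rb | le_br] := ltnP (n - r) b.
    by rewrite /depth_term (bin_small lt_rb) !(mul0r, mulr0).
  rewrite (_ : i + i' + n - a - b = i + (r - a) + (i' + (n - r - b)))%N; last by lia.
  by rewrite (exprD _ (i + (r - a))%N); ring.
(* If the exponent exceeds s + t, the weight vanishes by [rankin_cohen_vanish] with u = s - i and v
   = t - i'. *)
have [le_p | lt_p] := leqP (i + i' + n) (s + t + a + b); last first.
  have -> : w = 0.
    rewrite /w /bracket_weight /bracket_coef /depth_term.
    have lt_n : (s - i + (t - i') + a + b < n)%N by lia.
    rewrite -[RHS](@rankin_cohen_vanish K n (k - s).-1 (l - t).-1 _ _ _ _ lt_n).
    apply: eq_bigr => r _; have lt_rn := ltn_ord r.
    rewrite (_ : k - s + n - 1 = (k - s).-1 + n)%N; last by lia.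
    rewrite (_ : l - t + n - 1 = (l - t).-1 + n)%N; last by lia.
    rewrite (_ : k - i + r - 1 = (k - s).-1 + (s - i) + r)%N; last by lia.
    by rewrite (_ : l - i' + (n - r) - 1 = (l - t).-1 + (t - i') + (n - r))%N; last by lia.
  rewrite !mul0r big1 // => p _; case: eqP => [|_]; last by rewrite mul0r.
  by have := ltn_ord p; lia.
(* If n < a + b, no r satisfies a <= r <= n - b and the weight is zero; otherwise the subtractions
   in the exponent are exact. *)
have [lt_ab | le_ab] := ltnP n (a + b).
  have w0 : w = 0.
    rewrite /w /bracket_weight big1 // => r _; have lt_rn := ltn_ord r.
    have [lt_ra | le_ar] := ltnP r a.
      by rewrite /depth_term (bin_small lt_ra) !(mul0r, mulr0).
    by rewrite /depth_term ['C(n - r, b)]bin_small ?(mul0r, mulr0) //; lia.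
  rewrite w0 !mul0r big1 // => p _; rewrite -/w w0 !mul0r.
  by case: ifP; rewrite mul0r.
have lt_p : (i + i' + n - a - b < (s + t).+1)%N by lia.
rewrite (bigD1 (Ordinal lt_p)) //= ifT; last by apply/eqP; lia.
rewrite big1 ?addr0 // => p; rewrite -val_eqE /= => ne_p.
by rewrite ifF ?mul0r //; apply/eqP; move/eqP: ne_p; lia.
Qed.

(** This compares the coefficients of [A i a.+1] in F_(r+1) = D F_r + (k + 2 r) Y F_r. After the
    common falling factorial is taken out, what remains is (r - a) C(r, a) = (a + 1) C(r, a + 1). *)
Lemma depth_term_step (K : numFieldType) k i a r : (i < k)%N -> (a < r)%N ->
  depth_term K k i a r + (k + 2 * r)%:R * depth_term K k i a.+1 r
    = depth_term K k i a.+1 r.+1 + (i + (r - a.+1))%:R * depth_term K k i a.+1 r.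
Proof.
move=> lt_ik lt_ar; rewrite /depth_term.
have -> : (r - a = (r - a.+1).+1)%N by lia.
have -> : (k - i + r.+1 - 1 = (k - i + r - 1).+1)%N by lia.
have -> : (r.+1 - a.+1 = (r - a.+1).+1)%N by lia.
rewrite ffactnSr ffactSS binS !natrM natrD.
have binE : (r - a)%:R * 'C(r, a)%:R = a.+1%:R * 'C(r, a.+1)%:R :> K.
  by rewrite -!natrM mul_bin_left.
have -> : (k - i + r - 1).+1%:R = k%:R - i%:R + r%:R :> K.
  by rewrite -natrB ?(ltnW lt_ik) // -natrD; congr _%:R; lia.
have -> : (k - i + r - 1 - (r - a.+1))%:R = k%:R - i%:R + a%:R :> K.
  by rewrite -natrB ?(ltnW lt_ik) // -natrD; congr _%:R; lia.
move: binE; rewrite !natrD ?natrM !natrB // ?(ltnW lt_ar) // -!natr1 => binE.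
set F := (_ ^_ _)%:R; set x := 'C(r, a)%:R in binE *.
set y := 'C(r, a.+1)%:R in binE *.
transitivity ((k%:R - i%:R + a%:R) * F * x + (k%:R + 2 * r%:R) * F * y); first by ring.
apply/eqP; rewrite -subr_eq0; apply/eqP.
transitivity (F * ((a%:R + 1) * y - (r%:R - a%:R) * x)); first by ring.
by rewrite binE subrr mulr0.
Qed.

(** The double sum is the derivative of F_r under the rules D [A i a] = [A i a.+1] and D y = -
    y^2. *)
Lemma depth_expansion_step (K : numFieldType) k s (A : nat -> nat -> K) y r :
  (s < k)%N ->
  \sum_(i < s.+1) \sum_(a < r.+1) depth_term K k i a r *
      (A i a.+1 * y ^+ (i + (r - a)) - A i a * ((i + (r - a))%:R * y ^+ (i + (r - a)).+1))
    + (k + 2 * r)%:R * y * depth_expansion k s A y r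
  = depth_expansion k s A y r.+1.
Proof.
move=> lt_sk; rewrite /depth_expansion mulr_sumr -big_split /=.
apply: eq_bigr => i _; have lt_ik : (i < k)%N by have := ltn_ord i; lia.
pose T a := depth_term K k i a r; pose m a := (i + (r - a))%N.
transitivity (\sum_(a < r.+1) T a * A i a.+1 * y ^+ (m a) +
   \sum_(a < r.+1) ((k + 2 * r)%:R - (m a)%:R) * T a * A i a * y ^+ (m a).+1).
  rewrite mulr_sumr -!big_split /=; apply: eq_bigr => a _.
  by rewrite /T /m exprS; ring.
rewrite [X in _ + X]big_ord_recl [X in X + _]big_ord_recr /=.
rewrite [RHS]big_ord_recl [in RHS]big_ord_recr /=.
rewrite [X in X + _]addrC addrACA.
(* Boundary monomials: a = 0 comes only from the second sum, and a = r + 1, written [bump 0 r], only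
   from the first. The others are matched by [depth_term_step]. *)
rewrite [X in X + _](_ : _ = depth_term K k i 0 r.+1 * A i 0%N * y ^+ (i + (r.+1 - 0)) +
  depth_term K k i (bump 0 r) r.+1 * A i (bump 0 r) * y ^+ (i + (r.+1 - bump 0 r))); last first.
  rewrite addrC /T /m /bump /= add1n; congr (_ + _); last first.
    by rewrite /depth_term !binn !subnn !ffactn0.
  rewrite /depth_term !bin0 !subn0 !mul1r -addnS.
  have -> : (k - i + r.+1 - 1 = (k - i + r - 1).+1)%N by lia.
  rewrite ffactSS natrM; congr (_ * _ * _); congr (_ * _).
  by rewrite -natrB; [congr _%:R|]; lia.
rewrite [RHS](_ : _ = depth_term K k i 0 r.+1 * A i 0%N * y ^+ (i + (r.+1 - 0)) +
  depth_term K k i (bump 0 r) r.+1 * A i (bump 0 r) * y ^+ (i + (r.+1 - bump 0 r))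
  + \sum_(i0 < r) depth_term K k i (bump 0 i0) r.+1 * A i (bump 0 i0) *
    y ^+ (i + (r.+1 - bump 0 i0))); last by ring.
congr (_ + _).
rewrite -big_split /=; apply: eq_bigr => a _.
have lt_ar := ltn_ord a; rewrite /bump /= add1n.
have mE : m a = (m a.+1).+1 by rewrite /m; lia.
rewrite subSS mE -/(m a.+1) -[in RHS]/(m a) mE.
have := depth_term_step K lt_ik lt_ar; rewrite -/(T _) -/(T _) -/(m a.+1) => eqT.
transitivity ((T a + ((k + 2 * r)%:R * T a.+1) - (m a.+1)%:R * T a.+1)
    * A i a.+1 * y ^+ (m a.+1).+1); first by ring.
by rewrite eqT; ring.
Qed.

(** * Fourier series on the upper half-plane *)

Section Analysis.
Variable R : realType.
Local Notation C := (R[i]^o).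
Local Notation N := (@Normc.normc R).
Local Notation H := (@upper_half_plane R).
Implicit Types (f g : C -> C) (z w h : C).

Lemma normC_normc z : `|z| = (N z)%:C. Proof. by []. Qed.

Lemma normc_ge0 z : 0 <= N z.
Proof. by rewrite -ler0c -normC_normc normr_ge0. Qed.

Lemma normcD z w : N (z + w) <= N z + N w.
Proof. by rewrite -lecR rmorphD /= -!normC_normc ler_normD. Qed.

Lemma normcM z w : N (z * w) = N z * N w.
Proof. by apply: complexI; rewrite rmorphM /= -!normC_normc normrM. Qed.

Lemma normcX z n : N (z ^+ n) = N z ^+ n.
Proof. by apply: complexI; rewrite rmorphXn /= -!normC_normc normrX. Qed.

Lemma normcN z : N (- z) = N z.
Proof. by apply: complexI; rewrite -!normC_normc normrN. Qed.

Lemma normc_real (x : R) : N x%:C = `|x|.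
Proof. by rewrite /Normc.normc /= expr0n /= addr0 sqrtr_sqr. Qed.

Lemma normc_nat n : N n%:R = n%:R.
Proof. by rewrite -(rmorph_nat (real_complex R)) normc_real ger0_norm. Qed.

Lemma normc_sum (F : nat -> C) n :
  N (\sum_(i < n) F i) <= \sum_(i < n) N (F i).
Proof. by rewrite -lecR rmorph_sum /= -normC_normc ler_norm_sum. Qed.

Lemma Re_le_normc z : `|complex.Re z| <= N z.
Proof. by case: z => x y; rewrite /= -sqrtr_sqr ler_wsqrtr // lerDl sqr_ge0. Qed.

Lemma Im_le_normc z : `|complex.Im z| <= N z.
Proof. by case: z => x y; rewrite /= -sqrtr_sqr ler_wsqrtr // lerDr sqr_ge0. Qed.

Lemma normc_le_ReIm z : N z <= `|complex.Re z| + `|complex.Im z|.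
Proof.
rewrite [z in N z]complexE (le_trans (normcD _ _)) // normcM !normc_real.
by rewrite /= expr0n expr1n add0r sqrtr1 mul1r.
Qed.

(** Dividing by h bounds the error of the difference quotient by K |h|. *)
Lemma is_derive_quadratic f z (d : C) (K e : R) : 0 < e ->
  (forall h, N h < e -> N (f (z + h) - f z - h * d) <= K * N h ^+ 2) ->
  is_derive z 1 f d.
Proof.
move=> e_gt0 fP.
suff fd : (fun h => h^-1 *: ((f \o shift z) (h *: (1 : C)) - f z)) @ 0^' --> d.
  by apply: DeriveDef; [apply/cvg_ex; exists d | apply: cvg_lim fd].
(* In the order of [R[i]] a positive [eps] is real. The radius uses [|K| + 1] because K may be zero
   or negative. *)
apply/cvgrPdist_le => eps; rewrite ltcE /= => /andP[/eqP im_eps eps_gt0].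
have epsE : eps = (complex.Re eps)%:C by case: eps im_eps {eps_gt0} => a b /= ->.
pose r := Num.min e (complex.Re eps / (`|K| + 1)).
have r_gt0 : 0 < r by rewrite lt_min e_gt0 divr_gt0 // ltr_wpDl.
exists r%:C; first by rewrite /= ltcR.
move=> h /=; rewrite sub0r normrN normC_normc ltcR lt_min => /andP[lt_he lt_hK] h_neq0.
have Nh_gt0 : 0 < N h by rewrite -ltcR -normC_normc normr_gt0.
rewrite epsE normC_normc lecR -normcN opprB.
have -> : h^-1 *: (f (h *: (1 : C) + z) - f z) - d = h^-1 * (f (z + h) - f z - h * d).
  by rewrite mulrBr mulKf // [h *: 1]mulr1 (addrC z).
rewrite normcM -(ler_pM2l Nh_gt0) mulrA -normcM mulfV // Normc.normc1 mul1r.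
rewrite (le_trans (fP _ lt_he)) // expr2 mulrA mulrC ler_wpM2l ?normc_ge0 //.
apply: (@le_trans _ _ ((`|K| + 1) * N h)).
  by rewrite ler_wpM2r ?normc_ge0 // (le_trans (ler_norm K)) // lerDl.
by rewrite mulrC -ler_pdivlMr ?ltr_wpDl // ltW.
Qed.

(** * Second-order estimates for the exponential function *)

Lemma MVT_norm (u du : R -> R) (M y : R) :
  (forall x, is_derive x (1 : R) u (du x)) ->
  (forall x, `|x| <= `|y| -> `|du x| <= M) -> `|u y - u 0| <= M * `|y|.
Proof.
move=> udu du_le.
have cu a b : {within `[a, b], continuous u}.
  apply: continuous_subspaceT => x; apply: differentiable_continuous.
  by apply/derivable1_diffP; have [] := udu x.
have [y_ge0 | y_lt0] := lerP 0 y.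
  have [c] := MVT_segment y_ge0 (fun x _ => udu x) (cu _ _).
  rewrite in_itv /= => /andP[c_ge0 c_le] ->.
  by rewrite subr0 normrM ler_wpM2r // du_le // !ger0_norm.
have [c] := MVT_segment (ltW y_lt0) (fun x _ => udu x) (cu _ _).
rewrite in_itv /= => /andP[c_ge c_le] eqc.
rewrite distrC eqc sub0r normrM normrN ler_wpM2r // du_le //.
by rewrite !ler0_norm ?lerN2 // ltW.
Qed.

Lemma abs_sin_le (y : R) : `|sin y| <= `|y|.
Proof.
have := @MVT_norm sin cos 1 y (fun x => is_derive_sin x).
by rewrite sin0 subr0 mul1r; apply => x _; apply: cos_max.
Qed.

Lemma abs_cosB1_le (y : R) : `|cos y - 1| <= `|y|.
Proof.
have := @MVT_norm cos (fun x => - sin x) 1 y (fun x => is_derive_cos x).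
by rewrite cos0 mul1r; apply => x _; rewrite normrN; apply: sin_max.
Qed.

Lemma abs_cosB1_le_sqr (y : R) : `|cos y - 1| <= `|y| ^+ 2.
Proof.
have := @MVT_norm cos (fun x => - sin x) `|y| y (fun x => is_derive_cos x).
rewrite cos0 -expr2; apply => x le_xy; rewrite normrN.
exact: le_trans (abs_sin_le x) le_xy.
Qed.

Lemma abs_sinB_le_sqr (y : R) : `|sin y - y| <= `|y| ^+ 2.
Proof.
have dsin x : is_derive x (1 : R) (sin - id : R -> R) (cos x - 1).
  exact: is_deriveB.
have := @MVT_norm _ _ `|y| y dsin.
rewrite !fctE sin0 !subr0 -expr2; apply => x le_xy.
exact: le_trans (abs_cosB1_le x) le_xy.
Qed.

(** Multiplying 1 - x <= exp(-x) by exp(x) gives exp(x) - 1 <= x exp(x), hence exp(x) - 1 - x <= x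
    (exp(x) - 1). For x < 0 the last factor is at least x, so x^2 already bounds the product. *)
Lemma abs_expRB1_le_sqr (x : R) :
  `|expR x - 1 - x| <= `|x| ^+ 2 * expR `|x|.
Proof.
have ge1 := expR_ge1Dx x; rewrite ger0_norm; last by lra.
have leM : expR x - 1 - x <= x * (expR x - 1).
  have := expR_ge1Dx (- x); rewrite -(ler_pM2r (expR_gt0 x)) -expRD addNr expR0.
  lra.
apply: le_trans leM _.
have [x_ge0 | x_lt0] := lerP 0 x.
  have leM : expR x - 1 <= x * expR x.
    have := expR_ge1Dx (- x).
    rewrite -(ler_pM2r (expR_gt0 x)) -expRD addNr expR0; lra.
  by rewrite ger0_norm // expr2 -[leRHS]mulrA ler_wpM2l.
rewrite (ler0_norm (ltW x_lt0)) sqrrN; apply: (@le_trans _ _ (x ^+ 2)).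
  rewrite expr2; apply: ler_wnM2l; [exact: ltW | lra].
by rewrite ler_peMr ?sqr_ge0 // ltW // expR_gt1; lra.
Qed.

Lemma cexpD z w : cexp (z + w) = cexp z * cexp w.
Proof.
case: z w => [x y] [x' y']; rewrite /cexp /= expRD cosD sinD.
by apply/eqP; rewrite eq_complex /=; apply/andP; split; apply/eqP; ring.
Qed.

Lemma cexp0 : cexp (0 : C) = 1.
Proof.
by rewrite /cexp /= expR0 cos0 sin0 mul1r.
Qed.

Lemma cexpMn z n : cexp z ^+ n = cexp (n%:R * z).
Proof.
elim: n => [|n IHn]; first by rewrite mul0r cexp0.
by rewrite exprSr IHn -cexpD -natr1 mulrDl mul1r.
Qed.

Lemma normc_cexp z : N (cexp z) = expR (complex.Re z).
Proof.
rewrite /cexp normcM normc_real /= cos2Dsin2 sqrtr1 mulr1 ger0_norm //.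
Qed.

(** For w = x + i y and E = exp(i y), the remainder is (exp(x) - 1 - x) E + (E - 1 - i y) + x (E -
    1). The three parts contribute 1, 2 and 2 to the constant 5. *)
Lemma cexp_quadratic w : N (cexp w - 1 - w) <= 5 * N w ^+ 2 * expR (N w).
Proof.
have [leR leI] := (Re_le_normc w, Im_le_normc w).
have N_ge0 := normc_ge0 w.
have ge1 : 1 <= expR (N w) by rewrite (le_trans _ (expR_ge1Dx _)) // lerDl.
move: (abs_expRB1_le_sqr (complex.Re w)) (abs_cosB1_le_sqr (complex.Im w)).
move: (abs_sinB_le_sqr (complex.Im w)) (abs_cosB1_le (complex.Im w)).
move: (abs_sin_le (complex.Im w)).
have -> : cexp w - 1 - w =
  (expR (complex.Re w) - 1 - complex.Re w)%:C *
     (cos (complex.Im w) +i* sin (complex.Im w)) +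
  ((cos (complex.Im w) - 1) +i* (sin (complex.Im w) - complex.Im w)) +
  (complex.Re w)%:C * ((cos (complex.Im w) - 1) +i* sin (complex.Im w)).
  case: w {leR leI N_ge0 ge1} => x y; rewrite /cexp /=.
  by apply/eqP; rewrite eq_complex /=; apply/andP; split; apply/eqP; ring.
move: (complex.Re w) (complex.Im w) leR leI => x y leR leI s1 s2 c1 e2 c2.
have xx : `|x| ^+ 2 <= N w ^+ 2 by rewrite lerXn2r ?nnegrE.
have yy : `|y| ^+ 2 <= N w ^+ 2 by rewrite lerXn2r ?nnegrE.
have xy : `|x| * `|y| <= N w ^+ 2 by rewrite expr2 ler_pM.
have t1 : N ((expR x - 1 - x)%:C * (cos y +i* sin y)) <= N w ^+ 2 * expR (N w).
  rewrite normcM normc_real /= cos2Dsin2 sqrtr1 mulr1 (le_trans e2) //.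
  by rewrite ler_pM ?ler_expR ?expR_ge0 ?exprn_ge0.
have t2 : N ((cos y - 1) +i* (sin y - y)) <= 2 * N w ^+ 2.
  rewrite (le_trans (normc_le_ReIm _)) //=; lra.
have t3 : N (x%:C * ((cos y - 1) +i* sin y)) <= 2 * N w ^+ 2.
  rewrite normcM normc_real.
  apply: (@le_trans _ _ (`|x| * (2 * `|y|))); last by lra.
  by rewrite ler_wpM2l // (le_trans (normc_le_ReIm _)) //=; lra.
apply: (@le_trans _ _ (N w ^+ 2 * expR (N w) + 4 * N w ^+ 2)).
  rewrite (le_trans (normcD _ _)) // (le_trans (lerD (normcD _ _) (lexx _))) //.
  lra.
have : N w ^+ 2 <= N w ^+ 2 * expR (N w) by rewrite ler_peMr // exprn_ge0.
lra.
Qed.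

(** * Convergence of complex series *)

Lemma cvg_normcP (u : nat -> C) (l : C) :
  u @ \oo --> l <->
  forall e : R, 0 < e -> exists n0, forall n, (n0 <= n)%N -> N (l - u n) <= e.
Proof.
split=> [/cvgrPdist_le ul e e_gt0|ul].
  have /ul[n0 _ n0P] : 0 < e%:C by rewrite ltcR.
  by exists n0 => n /n0P; rewrite /= normC_normc lecR.
apply/cvgrPdist_le => eps; rewrite ltcE /= => /andP[/eqP im_eps eps_gt0].
have [n0 n0P] := ul _ eps_gt0; exists n0 => // n /n0P.
by rewrite /= normC_normc lecE /= im_eps eqxx.
Qed.

Lemma seriesC (u : nat -> C) n : series u n = \sum_(i < n) u i.
Proof. by rewrite seriesEord. Qed.

Lemma cvg_series_sum (u : nat -> C) (l : C) :
  series u @ \oo --> l -> (fun n => \sum_(i < n) u i) @ \oo --> l.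
Proof. by rewrite seriesEord. Qed.

Lemma cvg_mulc (u v : nat -> C) (l m : C) : u @ \oo --> l -> v @ \oo --> m ->
  (fun n => u n * v n) @ \oo --> (l * m : C).
Proof. by move=> cu cv; apply: (@cvgM R[i] _ _ _ u v l m cu cv). Qed.

Lemma cvg_mulcl (c : C) (v : nat -> C) (m : C) : v @ \oo --> m ->
  (fun n => c * v n) @ \oo --> (c * m : C).
Proof. by move=> cv; apply: (@cvg_mulc (fun=> c) v c m _ cv); apply: cvg_cst. Qed.

Lemma normc_lim_le (u : nat -> C) (l : C) (B : R) :
  u @ \oo --> l -> (forall n, N (u n) <= B) -> N l <= B.
Proof.
move=> /cvg_normcP ul uB; apply/ler_addgt0Pl => e e_gt0.
have [n0 /(_ n0 (leqnn _)) le_e] := ul _ e_gt0.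
by rewrite -(subrK (u n0) l) (le_trans (normcD _ _)) // lerD.
Qed.

(** The real and imaginary parts are dominated by the modulus, so each gives an absolutely
    convergent real series. *)
Lemma cvg_bounded_series (u : nat -> C) (M : R) :
  (forall n, \sum_(i < n) N (u i) <= M) -> exists l : C, series u @ \oo --> l.
Proof.
move=> uM.
have part (p : C -> R) : (forall z, `|p z| <= N z) ->
    cvgn (series (fun n => p (u n))).
  move=> pN; apply: normed_cvg; apply: nondecreasing_is_cvgn.
    by apply: nondecreasing_series => n _ _ /=.
  exists M => _ [n _ <-]; apply: le_trans (uM n).
  by rewrite /= seriesEord ler_sum.
have /cvg_ex[/= x xP] := part _ Re_le_normc.
have /cvg_ex[/= y yP] := part _ Im_le_normc.
exists (x +i* y); apply/cvg_normcP => e e_gt0.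
have e2_gt0 : 0 < e / 2 by rewrite divr_gt0.
move/cvgrPdist_le : xP => /(_ _ e2_gt0)[n1 _ n1P].
move/cvgrPdist_le : yP => /(_ _ e2_gt0)[n2 _ n2P].
exists (maxn n1 n2) => n; rewrite geq_max => /andP[le_n1 le_n2].
have := lerD (n1P n le_n1) (n2P n le_n2); rewrite /= -splitr; apply: le_trans.
rewrite (le_trans (normc_le_ReIm _)) // seriesEnat /=.
have ReS : complex.Re (\sum_(0 <= k < n) u k) = \sum_(0 <= k < n) complex.Re (u k).
  by apply: big_morph => // -[? ?] [? ?].
have ImS : complex.Im (\sum_(0 <= k < n) u k) = \sum_(0 <= k < n) complex.Im (u k).
  by apply: big_morph => // -[? ?] [? ?].
by move: ReS ImS; case: (\sum_(0 <= k < n) u k) => a b /= -> ->.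
Qed.

(** * Power series converging in the unit disk *)

Lemma normc_pow_ge0 z r n : 0 < r -> 0 <= N z * r ^+ n.
Proof. by move=> r_gt0; rewrite mulr_ge0 ?normc_ge0 // exprn_ge0 // ltW. Qed.

(** Equivalent to a radius of convergence of at least 1; boundedness of terms is the form easiest to
    carry through operations on coefficients. *)
Definition tame (a : nat -> C) :=
  forall r : R, 0 < r < 1 -> exists M, forall n, N (a n) * r ^+ n <= M.

(** Boundedness at the midpoint r' of r and 1 dominates the terms at r by a geometric series of
    ratio r / r'. *)
Lemma tame_sum a r : tame a -> 0 < r < 1 ->
  exists2 M : R, 0 <= M & forall n, \sum_(i < n) N (a i) * r ^+ i <= M.
Proof.
move=> ta /andP[r_gt0 r_lt1]; pose r' := (1 + r) / 2.
have r'_gt0 : 0 < r' by rewrite /r'; lra.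
have [|M MP] := ta r'; first by rewrite r'_gt0 /r'; lra.
have M_ge0 : 0 <= M by rewrite (le_trans _ (MP 0)) // normc_pow_ge0.
have x_gt0 : 0 < r / r' by rewrite divr_gt0.
have x_lt1 : r / r' < 1 by rewrite ltr_pdivrMr // /r'; lra.
exists (M * (1 - r / r')^-1); first by rewrite mulr_ge0 // invr_ge0; lra.
move=> n; have /(le_trans _) : series (geometric M (r / r')) n <= M * (1 - r / r')^-1.
  by apply: geometric_le_lim => //; rewrite ger0_norm // ltW.
apply; rewrite !seriesEord /=; apply: ler_sum => i _.
rewrite -ler_pdivrMr ?exprn_gt0 // -mulrA -exprVn -exprMn invf_div mulrCA.
by rewrite mulfV ?gt_eqF // mulr1.
Qed.

(** With r < r' < 1 and 1 + d = r' / r, Bernoulli's inequality d n <= (1 + d)^n lets the bound at r'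
    absorb the factor n. *)
Lemma tame_mulrn a : tame a -> tame (fun n => n%:R * a n).
Proof.
move=> ta r /andP[r_gt0 r_lt1]; pose r' := (1 + r) / 2.
have r'_gt0 : 0 < r' by rewrite /r'; lra.
have [|M MP] := ta r'; first by rewrite r'_gt0 /r'; lra.
have M_ge0 : 0 <= M by rewrite (le_trans _ (MP 0)) // normc_pow_ge0.
pose d := r' / r - 1.
have d_gt0 : 0 < d by rewrite subr_gt0 ltr_pdivlMr // /r'; lra.
exists (M / d) => n; rewrite ler_pdivlMr //; apply: le_trans (MP n).
have bernoulli m : d * m%:R <= (1 + d) ^+ m.
  elim: m => [|m IHm]; first by rewrite mulr0 expr0.
  have : 1 <= (1 + d) ^+ m by rewrite exprn_ege1 //; lra.
  rewrite exprS -natr1; nra.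
have -> : r' ^+ n = (1 + d) ^+ n * r ^+ n.
  by rewrite -exprMn /d [1 + _]addrC subrK mulfVK // gt_eqF.
rewrite normcM normc_nat.
have -> : n%:R * N (a n) * r ^+ n * d = N (a n) * (d * n%:R * r ^+ n) by ring.
by rewrite ler_wpM2l ?normc_ge0 // ler_wpM2r // exprn_ge0 // ltW.
Qed.

Lemma tame_add a b : tame a -> tame b -> tame (fun n => a n + b n).
Proof.
move=> ta tb r r01; have [M MP] := ta _ r01; have [M' MP'] := tb _ r01.
exists (M + M') => n; apply: le_trans (lerD (MP n) (MP' n)).
by rewrite -mulrDl ler_wpM2r ?normcD // exprn_ge0 // ltW //; case/andP: r01.
Qed.

Lemma tame_scale (c : C) a : tame a -> tame (fun n => c * a n).
Proof.
move=> ta r r01; have [M MP] := ta _ r01; exists (N c * M) => n.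
by rewrite normcM -mulrA ler_wpM2l // normc_ge0.
Qed.

Definition cauchy_product (a b : nat -> C) n := \sum_(i < n.+1) a i * b (n - i)%N.

(** Since r^n = r^i r^(n-i), summability of one factor and boundedness of the other suffice. *)
Lemma tame_cauchy a b : tame a -> tame b -> tame (cauchy_product a b).
Proof.
move=> ta tb r r01; have [S S_ge0 SP] := tame_sum ta r01; have [M MP] := tb _ r01.
have r_gt0 : 0 < r by case/andP: r01.
exists (S * M) => n.
apply: (@le_trans _ _ (\sum_(i < n.+1) (N (a i) * r ^+ i) * (N (b (n - i)%N) * r ^+ (n - i)))).
  apply: le_trans (ler_wpM2r _ (normc_sum (fun i => a i * b (n - i)%N) _)) _.
    by rewrite exprn_ge0 // ltW.
  rewrite mulr_suml; apply: ler_sum => i _; rewrite normcM mulrACA -exprD subnKC //.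
  by rewrite -ltnS.
have M_ge0 : 0 <= M by rewrite (le_trans _ (MP 0)) // normc_pow_ge0.
apply: le_trans (ler_wpM2r M_ge0 (SP n.+1)); rewrite mulr_suml.
by apply: ler_sum => i _; rewrite ler_wpM2l // normc_pow_ge0.
Qed.

Lemma tame_cvg a (q : C) : tame a -> 0 < N q < 1 ->
  exists l : C, series (fun n => a n * q ^+ n) @ \oo --> l.
Proof.
move=> ta q01; have [M _ MP] := tame_sum ta q01.
apply: (@cvg_bounded_series _ M) => n; apply: le_trans (MP n).
by apply: ler_sum => i _; rewrite normcM normcX.
Qed.

Lemma triangular_sum (V : nmodType) (F : nat -> nat -> V) n :
  \sum_(k < n) \sum_(i < k.+1) F i (k - i)%N =
  \sum_(i < n) \sum_(j < n) if (i + j < n)%N then F i j else 0.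
Proof.
transitivity (\sum_(k < n) \sum_(i < n) \sum_(j < n) if (i + j == k)%N then F i j else 0).
  apply: eq_bigr => k _; have lt_kn := ltn_ord k.
  rewrite (big_ord_widen n (fun i => F i (k - i)%N)) // big_mkcond /=.
  apply: eq_bigr => i _; case: ltnP => [le_ik|lt_ki]; last first.
    by rewrite big1 // => j _; rewrite ifF //; apply/eqP; lia.
  have lt_j : (k - i < n)%N by lia.
  rewrite (bigD1 (Ordinal lt_j)) //= ifT; last by apply/eqP; lia.
  rewrite big1 ?addr0 // => j; rewrite -val_eqE /= => ne_j.
  by rewrite ifF //; apply/eqP; move/eqP: ne_j; lia.
rewrite exchange_big; apply: eq_bigr => i _; rewrite exchange_big.
apply: eq_bigr => j _; case: ltnP => [lt_n | le_n].
  rewrite (bigD1 (Ordinal lt_n)) //= eqxx big1 ?addr0 // => k.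
  by rewrite -val_eqE /= eq_sym => /negPf ->.
by rewrite big1 // => k _; rewrite ifF //; apply/eqP; have := ltn_ord k; lia.
Qed.

(** The product of the partial sums differs from the partial sum of the product by the terms with i,
    j < n <= i + j. Writing |q| = x r with x, r < 1, these total at most [Sa * Sb * x ^+ n], which
    tends to 0. *)
Lemma cvg_cauchy_product a b (q la lb : C) : tame a -> tame b -> 0 < N q < 1 ->
  series (fun n => a n * q ^+ n) @ \oo --> la ->
  series (fun n => b n * q ^+ n) @ \oo --> lb ->
  series (fun n => cauchy_product a b n * q ^+ n) @ \oo --> (la * lb : C).
Proof.
move=> ta tb /andP[q_gt0 q_lt1] cva cvb; pose r := (1 + N q) / 2.
have r_gt0 : 0 < r by rewrite /r; lra.
have r01 : 0 < r < 1 by rewrite r_gt0 /r; lra.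
have [Sa Sa_ge0 SaP] := tame_sum ta r01; have [Sb Sb_ge0 SbP] := tame_sum tb r01.
pose x := N q / r.
have x_gt0 : 0 < x by rewrite divr_gt0.
have x_lt1 : x < 1 by rewrite ltr_pdivrMr // /r; lra.
have Nq : N q = x * r by rewrite /x divfK // gt_eqF.
clearbody x; clearbody r.
have AB : (fun n => series (fun n => a n * q ^+ n) n * series (fun n => b n * q ^+ n) n)
    @ \oo --> (la * lb : C) by exact: cvg_mulc cva cvb.
apply/cvg_normcP => e e_gt0.
move/cvg_normcP : AB => /(_ (e / 2))[|n1 n1P]; first by rewrite divr_gt0.
have := @cvg_geometric R (Sa * Sb) x; rewrite ger0_norm ?ltW // => /(_ x_lt1).
move=> /cvgrPdist_le /(_ (e / 2))[|n2 _ n2P]; first by rewrite divr_gt0.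
exists (maxn n1 n2) => n; rewrite geq_max => /andP[/n1P le1 /n2P].
rewrite /= sub0r normrN => le2.
set c := series _ n; set A := series _ n in le1; set B := series _ n in le1.
rewrite -(subrK (A * B) (la * lb)) -addrA (splitr e).
apply: le_trans (normcD _ _) _; apply: lerD => //; apply: le_trans le2.
have -> : A * B - c = \sum_(i < n) \sum_(j < n)
    if (i + j < n)%N then 0 else (a i * q ^+ i) * (b j * q ^+ j).
  rewrite /A /B /c !seriesEord /=.
  under [X in _ - X]eq_bigr => k _.
    rewrite /cauchy_product mulr_suml.
    have -> : \sum_(i < k.+1) a i * b (k - i)%N * q ^+ k =
        \sum_(i < k.+1) (a i * q ^+ i) * (b (k - i)%N * q ^+ (k - i)).
      by apply: eq_bigr => i _; rewrite mulrACA -exprD subnKC // -ltnS.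
    over.
  rewrite (triangular_sum (fun i j => (a i * q ^+ i) * (b j * q ^+ j))).
  rewrite big_distrlr -sumrB; apply: eq_bigr => i _.
  rewrite -sumrB; apply: eq_bigr => j _.
  by case: ifP => _; rewrite ?subrr ?subr0.
apply: (@le_trans _ _ (\sum_(i < n) \sum_(j < n)
    ((N (a i) * r ^+ i) * (N (b j) * r ^+ j)) * x ^+ n)).
  apply: le_trans (normc_sum (fun i => \sum_(j < n)
    if (i + j < n)%N then 0 else (a i * q ^+ i) * (b j * q ^+ j)) _) _.
  apply: ler_sum => i _.
  apply: le_trans (normc_sum (fun j =>
    if (i + j < n)%N then 0 else (a i * q ^+ i) * (b j * q ^+ j)) _) _.
  apply: ler_sum => j _; case: ltnP => [_|le_n].
    by rewrite Normc.normc0 !mulr_ge0 ?normc_ge0 ?exprn_ge0 // ltW.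
  have -> : N (a i * q ^+ i * (b j * q ^+ j)) =
      N (a i) * r ^+ i * (N (b j) * r ^+ j) * x ^+ (i + j).
    by rewrite !normcM !normcX Nq !exprMn exprD; ring.
  rewrite ler_wpM2l ?mulr_ge0 ?normc_ge0 ?exprn_ge0 ?(ltW r_gt0) //.
  by apply: ler_wiXn2l; rewrite ?ltW.
apply: le_trans (ler_norm _).
have -> : \sum_(i < n) \sum_(j < n) N (a i) * r ^+ i * (N (b j) * r ^+ j) * x ^+ n
   = (\sum_(i < n) N (a i) * r ^+ i) * (\sum_(j < n) N (b j) * r ^+ j) * x ^+ n.
  rewrite big_distrlr mulr_suml; apply: eq_bigr => i _.
  by rewrite mulr_suml.
rewrite ler_wpM2r ?exprn_ge0 ?(ltW x_gt0) // ler_pM // sumr_ge0 // => i _;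
exact: normc_pow_ge0.
Qed.

(** * Fourier expansions and termwise differentiation *)

Lemma normc_nome z : N (nome z) = expR (- (2 * pi * complex.Im z)).
Proof.
rewrite /nome normc_cexp; congr expR.
by case: z => x y /=; rewrite mul0r sub0r.
Qed.

Lemma normc_nome01 z : H z -> 0 < N (nome z) < 1.
Proof.
move=> Hz; rewrite normc_nome expR_gt0 expR_lt1 oppr_lt0.
by rewrite mulr_gt0 // mulr_gt0 // pi_gt0.
Qed.

Definition has_fourier f (a : nat -> C) :=
  tame a /\ forall z, H z -> series (fun n => a n * nome z ^+ n) @ \oo --> f z.

(** Convergence at a point where the nome has modulus r forces the terms to tend to 0, so a_n r^n is
    bounded. *)
Lemma fourier_has_fourier f : fourier_nonneg f -> exists a, has_fourier f a.
Proof.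
move=> [a fa]; exists a; split => // r /andP[r_gt0 r_lt1].
have [x rE] := expR_total r_gt0.
have x_lt0 : x < 0 by rewrite -expR_lt1 rE.
have pi2_gt0 : 0 < 2 * pi :> R by rewrite mulr_gt0 // pi_gt0.
(* As r = exp(x), this point of the imaginary axis has a nome of modulus r. *)
pose z : C := 0 +i* (- x / (2 * pi)).
have Hz : H z by rewrite /upper_half_plane /= divr_gt0 // oppr_gt0.
have Nz : N (nome z) = r.
  by rewrite normc_nome /= mulrC divfK ?gt_eqF // opprK.
have /cvgP/cvg_series_cvg_0/cvg_normcP/(_ _ ltr01)[n0 n0P] := fa _ Hz.
have aN n : N (a n * nome z ^+ n) = N (a n) * r ^+ n by rewrite normcM normcX Nz.
(* From [n0] on each term is at most 1; the earlier ones are bounded by their sum. *)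
exists (1 + \sum_(i < n0) N (a i) * r ^+ i) => n.
have [le_n | lt_n] := leqP n0 n.
  apply: (@le_trans _ _ 1); last by rewrite lerDl sumr_ge0 // => i _; apply: normc_pow_ge0.
  by have := n0P n le_n; rewrite sub0r normcN aN.
rewrite (bigD1 (Ordinal lt_n)) //= addrCA lerDl addr_ge0 // sumr_ge0 // => i _.
exact: normc_pow_ge0.
Qed.

Lemma has_fourier_fourier f a : has_fourier f a -> fourier_nonneg f.
Proof. by case=> _ fa; exists a. Qed.

Lemma two_pi_i_neq0 : two_pi_i R != 0.
Proof. by rewrite eq_complex /= eqxx /= mulf_neq0 // gt_eqF // pi_gt0. Qed.

Lemma normc_two_pi_i : N (two_pi_i R) = 2 * pi.
Proof.
rewrite /two_pi_i /= expr0n add0r sqrtr_sqr ger0_norm //.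
by rewrite mulr_ge0 // pi_ge0.
Qed.

Lemma is_derive_D f z (d : C) : is_derive z 1 f (two_pi_i R * d) -> D f z = d.
Proof.
by move=> fd; rewrite /D derive1E derive_val mulKf // two_pi_i_neq0.
Qed.

(** Factor out nome(z)^n and apply [cexp_quadratic] to w = 2 pi i n h, whence 20 pi^2 = 5 (2 pi)^2.
    As |h| < Im z / 2, the exponent -2 pi Im z + 2 pi |h| is at most -pi Im z, a bound uniform in
    h. *)
Lemma nomeD_quadratic z h n : N h < complex.Im z / 2 ->
  N (nome (z + h) ^+ n - nome z ^+ n - h * (two_pi_i R * (n%:R * nome z ^+ n)))
  <= 20 * pi ^+ 2 * N h ^+ 2 * (n%:R * (n%:R * expR (- (pi * complex.Im z)) ^+ n)).
Proof.
move=> lt_h; pose w : C := n%:R * (two_pi_i R * h).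
have nomeE v : nome v ^+ n = cexp (n%:R * (two_pi_i R * v)) by rewrite cexpMn.
have -> : nome (z + h) ^+ n - nome z ^+ n - h * (two_pi_i R * (n%:R * nome z ^+ n)) =
    nome z ^+ n * (cexp w - 1 - w).
  by rewrite !nomeE mulrDr mulrDr cexpD -/w /w; ring.
have Nw : N w = n%:R * (2 * pi * N h) by rewrite !normcM normc_nat normc_two_pi_i.
have pi_gt0 := @pi_gt0 R.
rewrite normcM normcX normc_nome.
apply: le_trans (ler_wpM2l _ (cexp_quadratic w)) _; first by rewrite exprn_ge0 // expR_ge0.
have n_ge0 : 0 <= n%:R :> R by [].
have -> : expR (- (2 * pi * complex.Im z)) ^+ n * (5 * N w ^+ 2 * expR (N w)) =
  20 * pi ^+ 2 * N h ^+ 2 * (n%:R * (n%:R *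
    expR (n%:R * (- (2 * pi * complex.Im z) + 2 * pi * N h)))).
  have eE (x y : R) : expR (n%:R * (x + y)) = expR x ^+ n * expR (n%:R * y).
    by rewrite mulrDr expRD expRM_natl.
  by rewrite eE Nw; ring.
rewrite ler_wpM2l ?mulr_ge0 ?exprn_ge0 ?normc_ge0 ?(ltW pi_gt0) //.
rewrite !ler_wpM2l // -expRM_natl ler_expR ler_wpM2l //.
nra.
Qed.

(** The quadratic estimates of the single terms are summed against n^2 a_n, which is again tame; the
    bound on partial sums passes to the limit. *)
Lemma is_derive_fourier f a z (l : C) : has_fourier f a -> H z ->
  series (fun n => n%:R * a n * nome z ^+ n) @ \oo --> l ->
  is_derive z 1 f (two_pi_i R * l).
Proof.
move=> [ta fa] Hz cvl; have pi_gt0 := @pi_gt0 R.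
have y_gt0 : 0 < complex.Im z by [].
pose r := expR (- (pi * complex.Im z)).
have r01 : 0 < r < 1 by rewrite expR_gt0 expR_lt1 oppr_lt0 mulr_gt0.
have [M M_ge0 MP] := tame_sum (tame_mulrn (tame_mulrn ta)) r01.
apply: (@is_derive_quadratic _ _ _ (20 * pi ^+ 2 * M) (complex.Im z / 2)).
  by rewrite divr_gt0.
move=> h lt_h.
have Hzh : H (z + h).
  have := Im_le_normc h; rewrite /upper_half_plane /=.
  have -> : complex.Im (z + h) = complex.Im z + complex.Im h by case: z {Hz cvl y_gt0 r r01 MP lt_h}; case: h.
  by rewrite ler_norml => /andP[+ _]; move: lt_h; lra.
pose u n : C := \sum_(k < n) a k * nome (z + h) ^+ k -
   \sum_(k < n) a k * nome z ^+ k -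
   h * (two_pi_i R * (\sum_(k < n) k%:R * a k * nome z ^+ k)).
apply: (@normc_lim_le u).
  apply: cvgB; last by apply: cvg_mulcl; apply: cvg_mulcl; apply: cvg_series_sum cvl.
  exact: cvgB (cvg_series_sum (fa _ Hzh)) (cvg_series_sum (fa _ Hz)).
move=> n; rewrite /u.
have -> : \sum_(k < n) a k * nome (z + h) ^+ k - \sum_(k < n) a k * nome z ^+ k -
   h * (two_pi_i R * (\sum_(k < n) k%:R * a k * nome z ^+ k)) =
   \sum_(k < n) a k * (nome (z + h) ^+ k - nome z ^+ k -
     h * (two_pi_i R * (k%:R * nome z ^+ k))).
  by rewrite !mulr_sumr -!sumrB; apply: eq_bigr => k _; ring.
apply: le_trans (normc_sum (fun k => a k * (nome (z + h) ^+ k - nome z ^+ k -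
     h * (two_pi_i R * (k%:R * nome z ^+ k)))) _) _.
apply: (@le_trans _ _ (20 * pi ^+ 2 * N h ^+ 2 *
   \sum_(i < n) N (i%:R * (i%:R * a i)) * r ^+ i)).
  rewrite mulr_sumr; apply: ler_sum => i _.
  rewrite normcM; apply: le_trans (ler_wpM2l (normc_ge0 _) (nomeD_quadratic _ lt_h)) _.
  by rewrite !normcM normc_nat -/r le_eqVlt; apply/orP; left; apply/eqP; ring.
rewrite mulrAC ler_wpM2r ?exprn_ge0 ?normc_ge0 // ler_wpM2l //.
by rewrite mulr_ge0 // exprn_ge0 // ltW.
Qed.

Lemma fourier_D f a : has_fourier f a ->
  holomorphic f /\ has_fourier (D f) (fun n => n%:R * a n).
Proof.
move=> fa; have ta := tame_mulrn fa.1.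
have dP z (Hz : H z) : exists l : C,
    series (fun n => n%:R * a n * nome z ^+ n) @ \oo --> l /\
    is_derive z 1 f (two_pi_i R * l).
  have [l lP] := tame_cvg ta (normc_nome01 Hz).
  by exists l; split; [exact: lP | exact: is_derive_fourier fa Hz lP].
split=> [z Hz|]; first by have [l [_ []]] := dP z Hz.
by split=> // z Hz; have [l [? /is_derive_D ->]] := dP z Hz.
Qed.

Lemma fourier_iterD f a n : has_fourier f a -> exists b, has_fourier (iter n (@D R) f) b.
Proof.
by move=> fa; elim: n => [|n [b /fourier_D[_ IHn]]]; [exists a | eexists; exact: IHn].
Qed.

Lemma fourier_mul f g a b : has_fourier f a -> has_fourier g b ->
  has_fourier (fun z => f z * g z) (cauchy_product a b).
Proof.
move=> [ta fa] [tb gb]; split; first exact: tame_cauchy.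
move=> z Hz; apply: cvg_cauchy_product => //; [exact: normc_nome01|exact: fa|exact: gb].
Qed.

Lemma fourier_add f g a b : has_fourier f a -> has_fourier g b ->
  has_fourier (fun z => f z + g z) (fun n => a n + b n).
Proof.
move=> [ta fa] [tb gb]; split=> [|z Hz]; first exact: tame_add.
have -> : series (fun n => (a n + b n) * nome z ^+ n) =
  series (fun n => a n * nome z ^+ n) \+ series (fun n => b n * nome z ^+ n).
  apply/funext => n; rewrite /= !seriesC -big_split /=.
  by apply: eq_bigr => i _; rewrite mulrDl.
by apply: cvgD; [apply: fa | apply: gb].
Qed.

Lemma fourier_scale (c : C) f a : has_fourier f a ->
  has_fourier (fun z => c * f z) (fun n => c * a n).
Proof.
move=> [ta fa]; split=> [|z Hz]; first exact: tame_scale.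
have -> : series (fun n => (c * a n) * nome z ^+ n) =
  (fun n => c * series (fun n => a n * nome z ^+ n) n).
  apply/funext => n; rewrite /= !seriesC mulr_sumr.
  by apply: eq_bigr => i _; rewrite mulrA.
exact: cvg_mulcl (fa _ Hz).
Qed.

Lemma fourier_sum n (F : 'I_n -> C -> C) :
  (forall i, exists a, has_fourier (F i) a) ->
  exists a, has_fourier (fun z => \sum_(i < n) F i z) a.
Proof.
elim: n F => [|n IHn] F FP.
  exists (fun=> 0); split=> [r _|z _].
    by exists 0 => n; rewrite Normc.normc0 mul0r.
  rewrite big_ord0 (_ : series _ = cst 0); first exact: cvg_cst.
  by apply/funext => n; rewrite seriesC big1 // => i _; rewrite mul0r.
have [a aP] := IHn (fun i => F (lift ord0 i)) (fun i => FP _).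
have [b bP] := FP ord0; eexists.
rewrite (_ : (fun z => _) = (fun z => F ord0 z + \sum_(i < n) F (lift ord0 i) z)).
  exact: fourier_add bP aP.
by apply/funext => z; rewrite big_ord_recl.
Qed.

End Analysis.

(** * Iterated complex differentiation *)

Lemma is_derive_comp (K : numFieldType) (f g : K -> K) (x df dg : K) :
  is_derive x 1 g dg -> is_derive (g x) 1 f df ->
  is_derive x 1 (f \o g) (dg * df).
Proof.
move=> [/derivable1_diffP Dg <-] [/derivable1_diffP Df <-].
have Dfg : differentiable (f \o g) x by apply: differentiable_comp.
apply: DeriveDef; first exact/derivable1_diffP.
rewrite (deriveE _ Dfg) (diff_comp Dg Df) /= (deriveE _ Dg) (deriveE _ Df).
rewrite -[X in 'd f _ X = _]mulr1.
by rewrite [LHS]linearZ.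
Qed.

Section Smooth.
Variable R : realType.
Local Notation C := (R[i]^o).
Local Notation N := (@Normc.normc R).
Local Notation H := (@upper_half_plane R).
Local Notation tpi := (two_pi_i R).
Implicit Types (f g : C -> C) (z w h d : C).

(** Differentiability together with the value of [D f]; the factor 2 pi i makes [d] that value. *)
Definition hasD f z d := is_derive z 1 f (tpi * d).

Lemma hasD_val f z d : hasD f z d -> D f z = d.
Proof. exact: is_derive_D. Qed.

Lemma hasD_derivable f z d : hasD f z d -> derivable f z 1.
Proof. by case. Qed.

Lemma derivable_hasD f z : derivable f z 1 -> hasD f z (D f z).
Proof.
move=> df; rewrite /hasD /D derive1E mulVKf ?two_pi_i_neq0 //.
Qed.

Lemma near_upper_half_plane z : H z -> \forall w \near z, H w.
Proof.
move=> Hz; apply/nbhs_ballP; exists (complex.Im z)%:C; first by rewrite /= ltcR.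
move=> w; rewrite /ball /= normC_normc ltcR => lt_zw.
have := le_lt_trans (Im_le_normc (z - w)) lt_zw.
rewrite /upper_half_plane /=; case: z w {Hz lt_zw} => [x y] [x' y'] /=.
by rewrite ltr_norml => /andP[_]; lra.
Qed.

(** The upper half-plane is open, so f and g agree near z. *)
Lemma hasD_ext f g z d : H z -> (forall w, H w -> f w = g w) ->
  hasD f z d -> hasD g z d.
Proof.
move=> Hz fg; apply: near_eq_is_derive.
by apply: filterS (near_upper_half_plane Hz) => w; apply: fg.
Qed.

Lemma hasD_cst (c : C) z : hasD (fun=> c) z 0.
Proof. by rewrite /hasD mulr0; apply: is_derive_cst. Qed.

Lemma hasD_id z : hasD id z tpi^-1.
Proof. by rewrite /hasD mulfV ?two_pi_i_neq0 //; apply: is_derive_id. Qed.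

Lemma hasD_add f g z d d' : hasD f z d -> hasD g z d' ->
  hasD (fun w => f w + g w) z (d + d').
Proof. by move=> ? ?; rewrite /hasD mulrDr; apply: is_deriveD. Qed.

Lemma hasD_mul f g z d d' : hasD f z d -> hasD g z d' ->
  hasD (fun w => f w * g w) z (d * g z + f z * d').
Proof.
move=> df dg; rewrite /hasD (_ : tpi * _ = f z *: (tpi * d') + g z *: (tpi * d)).
  exact: is_deriveM.
by rewrite /GRing.scale /=; ring.
Qed.

Lemma hasD_scale (c : C) f z d : hasD f z d -> hasD (fun w => c * f w) z (c * d).
Proof.
by move=> df; have := hasD_mul (hasD_cst c z) df; rewrite mul0r add0r.
Qed.

Lemma hasD_exp f z d n : hasD f z d ->
  hasD (fun w => f w ^+ n) z (n%:R * f z ^+ n.-1 * d).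
Proof.
move=> df; elim: n => [|n IHn]; first by rewrite !mul0r; apply: hasD_cst.
have := hasD_mul df IHn; rewrite (_ : _ + _ = n.+1%:R * f z ^+ n.+1.-1 * d).
  by under eq_fun do rewrite -exprS.
by case: n {IHn} => [|n] /=; rewrite -?natr1 ?exprS; ring.
Qed.

Lemma hasD_sum n (F : 'I_n -> C -> C) z (d : 'I_n -> C) :
  (forall i, hasD (F i) z (d i)) ->
  hasD (fun w => \sum_(i < n) F i w) z (\sum_(i < n) d i).
Proof.
elim: n F d => [|n IHn] F d Fd.
  by under eq_fun do rewrite big_ord0; rewrite big_ord0; apply: hasD_cst.
under eq_fun do rewrite big_ord_recl; rewrite big_ord_recl.
by apply: hasD_add => //; apply: IHn.
Qed.

Lemma hasD_inv f z d : f z != 0 -> hasD f z d ->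
  hasD (fun w => (f w)^-1) z (- (f z)^-1 ^+ 2 * d).
Proof.
move=> fz_neq0 [df dfE]; apply: DeriveDef; first exact: derivableV.
by rewrite deriveV // dfE /GRing.scale /= exprVn; ring.
Qed.

Lemma hasD_comp f g z d d' : hasD g z d -> hasD f (g z) d' ->
  hasD (f \o g) z (tpi * d * d').
Proof. by move=> dg df; rewrite /hasD mulrCA; apply: (@is_derive_comp R[i]). Qed.

(** Counting the derivatives lets closure under products, inverses and composition go by induction
    on n, since each derivative formula needs its constituents only to order n - 1. *)
Fixpoint smoothn n f :=
  if n is n'.+1 then holomorphic f /\ smoothn n' (D f) else True.

Definition smooth f := forall n, smoothn n f.

Lemma smooth_iterD f n : smooth f -> smooth (iter n (@D R) f).
Proof.
by move=> sf; elim: n => //= n IHn m; have [] := IHn m.+1.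
Qed.

Lemma smooth_holomorphic f : smooth f -> holomorphic f.
Proof. by move=> /(_ 1%N)[]. Qed.

Lemma smooth_hasD f z : smooth f -> H z -> hasD f z (D f z).
Proof. by move=> /smooth_holomorphic hf Hz; apply/derivable_hasD/hf. Qed.

Lemma fourier_smooth f a : has_fourier f a -> smooth f.
Proof. by move=> fa n; elim: n f a fa => //= n IHn f a /fourier_D[hf /IHn]. Qed.

Lemma holomorphic_hasD f z : holomorphic f -> H z -> hasD f z (D f z).
Proof. by move=> hf Hz; apply/derivable_hasD/hf. Qed.


Lemma eq_smoothn n f g : (forall z, H z -> f z = g z) -> smoothn n f -> smoothn n g.
Proof.
elim: n f g => [|n IHn] f g fg; first by [].
move=> [hf sDf].
have fgD z (Hz : H z) : hasD g z (D f z).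
  exact: hasD_ext Hz fg (holomorphic_hasD hf Hz).
split; first by move=> z Hz; apply: hasD_derivable (fgD z Hz).
by apply: IHn sDf => z Hz; rewrite (hasD_val (fgD z Hz)).
Qed.

Lemma smoothnS n f g : (forall z, H z -> hasD f z (g z)) -> smoothn n g ->
  smoothn n.+1 f.
Proof.
move=> fg sg; split; first by move=> z Hz; apply: hasD_derivable (fg z Hz).
by apply: eq_smoothn sg => z Hz; rewrite (hasD_val (fg z Hz)).
Qed.

Lemma smoothnW n f : smoothn n.+1 f -> smoothn n f.
Proof. by elim: n f => [|n IHn] f; [|move=> [hf /IHn]]. Qed.

Lemma smoothn_cst n (c : C) : smoothn n (fun=> c).
Proof.
elim: n c => [|n IHn] c; first by [].
 apply: (smoothnS (g := fun=> 0)) => // z _.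
exact: hasD_cst.
Qed.

Lemma smoothn_add n f g : smoothn n f -> smoothn n g -> smoothn n (fun z => f z + g z).
Proof.
elim: n f g => [|n IHn] f g; first by [].
move=> [hf sf] [hg sg].
apply: (smoothnS (g := fun z => D f z + D g z)) (IHn _ _ sf sg) => z Hz.
exact: hasD_add (holomorphic_hasD hf Hz) (holomorphic_hasD hg Hz).
Qed.

Lemma smoothn_mul n f g : smoothn n f -> smoothn n g -> smoothn n (fun z => f z * g z).
Proof.
elim: n f g => [|n IHn] f g; first by [].
move=> sf sg; have [[hf sDf] [hg sDg]] := (sf, sg).
apply: (smoothnS (g := fun z => D f z * g z + f z * D g z)).
  move=> z Hz.
  exact: hasD_mul (holomorphic_hasD hf Hz) (holomorphic_hasD hg Hz).
exact: smoothn_add (IHn _ _ sDf (smoothnW sg)) (IHn _ _ (smoothnW sf) sDg).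
Qed.

Lemma smoothn_exp n f k : smoothn n f -> smoothn n (fun z => f z ^+ k).
Proof.
move=> sf; elim: k => [|k IHk]; first exact: smoothn_cst.
by under eq_fun do rewrite exprS; exact: smoothn_mul sf IHk.
Qed.

Lemma smoothn_sum n (I : Type) (r : seq I) (F : I -> C -> C) :
  (forall i, smoothn n (F i)) -> smoothn n (fun z => \sum_(i <- r) F i z).
Proof.
move=> sF; elim: r => [|i r IHr].
  by under eq_fun do rewrite big_nil; apply: smoothn_cst.
by under eq_fun do rewrite big_cons; exact: smoothn_add (sF i) IHr.
Qed.

Lemma smoothn_inv n f : (forall z, H z -> f z != 0) -> smoothn n f ->
  smoothn n (fun z => (f z)^-1).
Proof.
move=> f_neq0; elim: n => [|n IHn]; first by [].
move=> sf; have [hf sDf] := sf.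
apply: (smoothnS (g := fun z => -1 * (f z)^-1 ^+ 2 * D f z)).
  move=> z Hz; rewrite mulN1r.
  exact: hasD_inv (f_neq0 _ Hz) (holomorphic_hasD hf Hz).
apply: smoothn_mul sDf; apply: smoothn_mul (smoothn_cst _ _) _.
exact: smoothn_exp (IHn (smoothnW sf)).
Qed.

Lemma smoothn_comp n f g : (forall z, H z -> H (g z)) -> smoothn n f -> smoothn n g ->
  smoothn n (f \o g).
Proof.
move=> Hg; elim: n f => [|n IHn] f; first by [].
move=> [hf sDf] sg; have [hg sDg] := sg.
apply: (smoothnS (g := fun z => tpi * D g z * (D f \o g) z)).
  move=> z Hz.
  exact: hasD_comp (holomorphic_hasD hg Hz) (holomorphic_hasD hf (Hg _ Hz)).
apply: smoothn_mul (IHn _ sDf (smoothnW sg)).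
exact: smoothn_mul (smoothn_cst _ _) sDg.
Qed.

Lemma smoothn_id n : smoothn n id.
Proof.
case: n => [|n]; first by [].
apply: (smoothnS (g := fun=> tpi^-1)) (smoothn_cst _ _) => z _.
exact: hasD_id.
Qed.

End Smooth.

(** * Modular transformations *)

Section Modular.
Variable R : realType.
Local Notation C := (R[i]^o).
Local Notation H := (@upper_half_plane R).
Local Notation tpi := (two_pi_i R).
Local Notation D := (@D R).
Implicit Types (f g : C -> C) (z w : C) (gamma : 'M[int]_2).

Lemma det_mx22 (A : 'M[int]_2) : \det A = A 0 0 * A 1 1 - A 0 1 * A 1 0.
Proof.
rewrite (expand_det_row _ 0) !big_ord_recl big_ord0 addr0 /cofactor !det_mx11 !mxE.
rewrite /= expr0 expr1 mul1r mulN1r mulrN.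
by congr (A _ _ * A _ _ - A _ _ * A _ _); apply/val_inj.
Qed.

Lemma natr_int_complex (m : int) : m%:~R = (m%:~R)%:C :> C.
Proof. by rewrite rmorph_int. Qed.

Lemma det_real gamma : \det gamma = 1 ->
  (gamma 0 0)%:~R * (gamma 1 1)%:~R - (gamma 0 1)%:~R * (gamma 1 0)%:~R = 1 :> R.
Proof. by rewrite det_mx22 => /(congr1 (fun m : int => m%:~R : R)); rewrite rmorphB !rmorphM. Qed.

(** If c z + d = 0, the imaginary part gives c = 0, then d = 0, against determinant 1. *)
Lemma autJ_neq0 gamma z : \det gamma = 1 -> H z -> autJ gamma z != 0.
Proof.
move=> /det_real; rewrite /autJ !natr_int_complex; case: z => x y.
rewrite /upper_half_plane /= => detE y_gt0.
move: ((gamma 0 0)%:~R) ((gamma 1 1)%:~R) ((gamma 0 1)%:~R) ((gamma 1 0)%:~R) detE.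
move=> a d b c detE.
rewrite eq_complex /=; apply/negP => /andP[/eqP + /eqP].
rewrite !mul0r subr0 addr0 addr0 => cxd /eqP; rewrite mulf_eq0 (gt_eqF y_gt0) orbF.
move=> /eqP c0; move: cxd detE; rewrite c0 mul0r add0r => ->.
by rewrite !mulr0 subr0 => /esym/eqP; rewrite oner_eq0.
Qed.

Lemma moebius_upper gamma z : \det gamma = 1 -> H z -> H (moebius gamma z).
Proof.
move=> det1 Hz; have J_neq0 := autJ_neq0 det1 Hz; move/det_real : det1.
move: J_neq0 Hz; rewrite /moebius /autJ !natr_int_complex; case: z => x y.
rewrite /upper_half_plane /=.
move: ((gamma 0 0)%:~R) ((gamma 1 1)%:~R) ((gamma 0 1)%:~R) ((gamma 1 0)%:~R).
move=> a d b c; rewrite eq_complex /= !mul0r !subr0 !addr0 => J_neq0 y_gt0 detE.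
set n2 := (_ ^+ 2 + _ ^+ 2).
have n2_gt0 : 0 < n2.
  rewrite lt_neqAle addr_ge0 ?sqr_ge0 // andbT eq_sym /n2 paddr_eq0 ?sqr_ge0 //.
  by rewrite !sqrf_eq0.
have -> : (a * x + b) * - (c * y / n2) + a * y * ((c * x + d) / n2) =
  (a * d - b * c) * y / n2 by field; rewrite gt_eqF.
by rewrite detE mul1r divr_gt0.
Qed.

Lemma hasD_autJ gamma z : hasD (autJ gamma) z ((gamma 1 0)%:~R * tpi^-1).
Proof.
rewrite -[_ * _]addr0; apply: hasD_add; last exact: hasD_cst.
exact: hasD_scale (hasD_id z).
Qed.

Lemma hasD_moebius gamma z : \det gamma = 1 -> H z ->
  hasD (moebius gamma) z (tpi^-1 * (autJ gamma z)^-1 ^+ 2).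
Proof.
move=> det1 Hz; have J_neq0 := autJ_neq0 det1 Hz.
have dnum : hasD (fun w => (gamma 0 0)%:~R * w + (gamma 0 1)%:~R) z
    ((gamma 0 0)%:~R * tpi^-1).
  rewrite -[_ * _]addr0; apply: hasD_add; last exact: hasD_cst.
  exact: hasD_scale (hasD_id z).
have := hasD_mul dnum (hasD_inv J_neq0 (hasD_autJ gamma z)).
rewrite (_ : _ + _ = tpi^-1 * (autJ gamma z)^-1 ^+ 2); first by [].
have detC : (gamma 0 0)%:~R * (gamma 1 1)%:~R - (gamma 0 1)%:~R * (gamma 1 0)%:~R = 1 :> C.
  by rewrite -!rmorphM -rmorphB -det_mx22 det1.
have JE : autJ gamma z = (gamma 1 0)%:~R * z + (gamma 1 1)%:~R by [].
have J1 : (autJ gamma z)^-1 * autJ gamma z = 1 by rewrite mulVf.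
move: detC JE J1; move: ((autJ gamma z)^-1) => J'; move: (autJ gamma z) => J; move: tpi^-1 => t.
move: ((gamma 0 0)%:~R) ((gamma 1 1)%:~R) ((gamma 0 1)%:~R) ((gamma 1 0)%:~R).
move=> a d b c detC JE J1.
transitivity (t * J' * (a * (J' * J) - J' * (a * z + b) * c)).
  by rewrite J1; ring.
rewrite JE; transitivity (t * J' ^+ 2 * (a * d - b * c)); first by ring.
by rewrite detC mulr1.
Qed.

Definition Y gamma z : C := tpi^-1 * X gamma z.

Lemma hasD_Y gamma z : \det gamma = 1 -> H z -> hasD (Y gamma) z (- Y gamma z ^+ 2).
Proof.
move=> det1 Hz; have J_neq0 := autJ_neq0 det1 Hz.
rewrite (_ : - _ = tpi^-1 * ((gamma 1 0)%:~R *
  (- (autJ gamma z)^-1 ^+ 2 * ((gamma 1 0)%:~R * tpi^-1)))).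
  exact: hasD_scale (hasD_scale _ (hasD_inv J_neq0 (hasD_autJ gamma z))).
by rewrite /Y /X; move: (tpi^-1) ((autJ gamma z)^-1) => t J; ring.
Qed.

(** The automorphy factor contributes - m Y, and the derivative (c z + d)^(-2) of the Möbius map
    raises the weight by 2. *)
Lemma hasD_slash gamma (m : nat) f z : \det gamma = 1 -> H z -> holomorphic f ->
  hasD (slash m f gamma) z
    (slash (m + 2) (D f) gamma z - m%:R * Y gamma z * slash m f gamma z).
Proof.
move=> det1 Hz hf; have J_neq0 := autJ_neq0 det1 Hz.
have dJ := @hasD_inv R (fun w => autJ gamma w ^+ m) z _ (expf_neq0 m J_neq0)
  (hasD_exp m (hasD_autJ gamma z)).
have dfm := hasD_comp (hasD_moebius det1 Hz) (holomorphic_hasD hf (moebius_upper det1 Hz)).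
have := hasD_mul dJ dfm.
rewrite (_ : _ + _ = slash (m + 2) (D f) gamma z - m%:R * Y gamma z * slash m f gamma z).
  by [].
rewrite /slash /Y /X (mulVKf (two_pi_i_neq0 _)) /=.
move: J_neq0; move: (f _) (D f _) (tpi^-1) (autJ gamma z) => u v t J J_neq0.
(* The derivative of the m-th power carries [m.-1], which is truncated at m = 0. *)
case: m {dJ dfm} => [|m]; first by field.
by rewrite /= exprD !exprS; field; rewrite expf_neq0 ?J_neq0.
Qed.

Lemma hasD_depth_expansion k s (Q : nat -> C -> C) gamma r z :
  \det gamma = 1 -> H z -> (forall i, smooth (Q i)) ->
  hasD (fun w => depth_expansion k s (fun i a => iter a D (Q i) w) (Y gamma w) r) z
   (\sum_(i < s.+1) \sum_(a < r.+1) depth_term R[i] k i a r *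
      (iter a.+1 D (Q i) z * Y gamma z ^+ (i + (r - a)) -
       iter a D (Q i) z * ((i + (r - a))%:R * Y gamma z ^+ (i + (r - a)).+1))).
Proof.
move=> det1 Hz sQ; apply: hasD_sum => i; apply: hasD_sum => a.
under eq_fun do rewrite -mulrA; apply: hasD_scale.
have dQ := smooth_hasD (smooth_iterD a (sQ i)) Hz.
have := hasD_mul dQ (hasD_exp (i + (r - a)) (hasD_Y det1 Hz)).
rewrite (_ : _ + _ = iter a.+1 D (Q i) z * Y gamma z ^+ (i + (r - a)) -
       iter a D (Q i) z * ((i + (r - a))%:R * Y gamma z ^+ (i + (r - a)).+1)) //=.
congr (_ + _); case: (i + (r - a))%N => [|m] /=; first by ring.
by rewrite !exprS; ring.
Qed.

Lemma slash_iterD k s f (Q : nat -> C -> C) gamma :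
  (s < k)%N -> \det gamma = 1 -> smooth f -> (forall i, smooth (Q i)) ->
  (forall z, H z -> slash k f gamma z = \sum_(i < s.+1) Q i z * Y gamma z ^+ i) ->
  forall r z, H z -> slash (k + 2 * r) (iter r D f) gamma z =
    depth_expansion k s (fun i a => iter a D (Q i) z) (Y gamma z) r.
Proof.
move=> lt_sk det1 sf sQ fQ; elim=> [|r IHr] z Hz.
  rewrite muln0 addn0 /= fQ // /depth_expansion; apply: eq_bigr => i _.
  rewrite big_ord1 /depth_term /= !subn0 !addn0 bin0 ffactn0.
  by rewrite !mul1r.
have hfr := smooth_holomorphic (smooth_iterD r sf).
have dG := hasD_slash (k + 2 * r) det1 Hz hfr.
(* The induction hypothesis holds on the whole half-plane, so both of its sides have the same
   derivative at z. *)
have := hasD_val (hasD_ext Hz IHr dG).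
rewrite (hasD_val (hasD_depth_expansion k s r det1 Hz sQ)) => /eqP.
rewrite eq_sym subr_eq IHr // => /eqP.
by rewrite -addnA -mulnSr depth_expansion_step // mulnSr.
Qed.

(** For fixed z the sum is a polynomial in j. Its finite difference of maximal order isolates the
    top P_i up to a nonzero constant; subtracting that term, one proceeds by induction. *)
Lemma smooth_coeffs n (P : nat -> C -> C) :
  (forall j : nat, smooth (fun z => \sum_(i < n) P i z * (z + j%:R) ^+ i)) ->
  forall i, (i < n)%N -> smooth (P i).
Proof.
elim: n P => // n IHn P sP.
have sPn : smooth (P n).
  pose S z := ((-1) ^+ n * n`!%:R)^-1 *
    \sum_(j < n.+1) (-1) ^+ j * 'C(n, j)%:R * (\sum_(i < n.+1) P i z * (z + j%:R) ^+ i).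
  move=> m; apply: (@eq_smoothn _ m S).
    move=> z _; pose p : {poly R[i]} := \sum_(i < n.+1) P i z *: ('X + z%:P) ^+ i.
    have szX i : size (('X + z%:P) ^+ i) = i.+1.
      by rewrite -['X + _]/('X + _) -[z]opprK rmorphN /= size_exp_XsubC.
    have le_p : (size p <= n.+1)%N.
      rewrite (leq_trans (size_sum _ _ _)) //; apply/bigmax_leqP => i _.
      by rewrite (leq_trans (size_scale_leq _ _)) // szX.
    have pn : p`_n = P n z.
      rewrite coef_sum big_ord_recr /= big1 ?add0r; last first.
        move=> i _; rewrite nth_default // (leq_trans (size_scale_leq _ _)) //.
        by rewrite szX.
      have := lead_coef_exp ('X + z%:P) n.
      by rewrite coefZ lead_coefXaddC expr1n /lead_coef szX => ->; rewrite mulr1.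
    have := finite_difference_horner le_p; rewrite pn /S => eqS.
    rewrite (_ : \sum_(j < n.+1) _ = (-1) ^+ n * n`!%:R * P n z).
      by rewrite mulKf // mulf_neq0 ?signr_eq0 // natr_fact_neq0.
    rewrite -eqS; apply: eq_bigr => j _; rewrite horner_sum; congr (_ * _).
    by apply: eq_bigr => i _; rewrite !hornerE [z + _]addrC.
  apply: smoothn_mul; first exact: smoothn_cst.
  apply: smoothn_sum => j; apply: smoothn_mul; [exact: smoothn_cst | exact: sP].
move=> i; rewrite ltnS leq_eqVlt => /predU1P[-> //|].
apply: IHn => j m; pose g z := -1 * (P n z * (z + j%:R) ^+ n).
apply: (@eq_smoothn _ m (fun z => \sum_(i < n.+1) P i z * (z + j%:R) ^+ i + g z)).
  by move=> z _; rewrite big_ord_recr /= /g mulN1r addrK.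
apply: smoothn_add; first exact: sP.
apply: smoothn_mul; first exact: smoothn_cst.
apply: smoothn_mul; first exact: sPn.
apply: smoothn_exp; apply: smoothn_add; [exact: smoothn_id | exact: smoothn_cst].
Qed.

Lemma Y_exp gamma z i : Y gamma z ^+ i = tpi^-1 ^+ i * X gamma z ^+ i.
Proof. exact: exprMn. Qed.

Lemma smoothn_autJ n gamma : smoothn n (@autJ R gamma).
Proof.
apply: smoothn_add; last exact: smoothn_cst.
exact: smoothn_mul (smoothn_cst _ _) (smoothn_id R _).
Qed.

Lemma smoothn_slash n m f gamma : \det gamma = 1 -> smoothn n f ->
  smoothn n (slash m f gamma).
Proof.
move=> det1 sf; have sJ := smoothn_autJ n gamma.
apply: smoothn_mul.
  apply: smoothn_inv; last exact: smoothn_exp.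
  by move=> z Hz; rewrite expf_neq0 // autJ_neq0.
apply: smoothn_comp sf _; first by move=> z; apply: moebius_upper.
apply: smoothn_mul.
  apply: smoothn_add; last exact: smoothn_cst.
  exact: smoothn_mul (smoothn_cst _ _) (smoothn_id R _).
by apply: smoothn_inv sJ => z; apply: autJ_neq0.
Qed.

(** The product S T^j of the standard generators, chosen so that c z + d = z + j and X = 1 / (z +
    j). *)
Definition inversion_shift (j : nat) : 'M[int]_2 :=
  \matrix_(p, q) if p == 0 then (if q == 0 then 0 else -1)
                 else (if q == 0 then 1 else j%:Z).

Lemma det_inversion_shift j : \det (inversion_shift j) = 1.
Proof. by rewrite det_mx22 !mxE /= mul0r mulN1r sub0r opprK. Qed.

Lemma autJ_inversion_shift j z : autJ (inversion_shift j) z = z + j%:R.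
Proof. by rewrite /autJ !mxE /= mul1r. Qed.

Lemma X_inversion_shift j z : X (inversion_shift j) z = (z + j%:R)^-1.
Proof. by rewrite /X autJ_inversion_shift !mxE /= mul1r. Qed.

(* Holomorphy of the [Q i] alone would require Cauchy's theory to get higher
   derivatives; instead the [Q i] are recovered from finitely many translates
   of [f], which has a Fourier series. *)
Lemma quasi_transform_smooth k s f : smooth f -> quasi_transform k s f ->
  exists Q : nat -> C -> C, (forall i, smooth (Q i)) /\
    forall gamma, \det gamma = 1 -> forall z, H z ->
      slash k f gamma z = \sum_(i < s.+1) Q i z * Y gamma z ^+ i.
Proof.
(* Multiplying the transformation law of S T^j by (z + j)^s turns (z + j)^(-i) into (z + j)^(s-i),
   so the coefficients appear in reversed order. *)
move=> sf [Q [_ QP]]; pose P i := Q (inord (s - i)).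
have sP : forall i, (i < s.+1)%N -> smooth (P i).
  apply: smooth_coeffs => j m; have det1 := det_inversion_shift j.
  apply: (@eq_smoothn _ m
    (fun z => (z + j%:R) ^+ s * slash k f (inversion_shift j) z)).
    move=> z Hz; rewrite QP // X_inversion_shift mulr_sumr.
    rewrite (reindex_inj rev_ord_inj) /=; apply: eq_bigr => i _.
    have le_is : (i <= s)%N by rewrite -ltnS.
    have -> : rev_ord i = inord (s - i).
      by apply/val_inj; rewrite /= inordK ?subSS // ltnS leq_subr.
    have zj_neq0 : z + j%:R != 0 by rewrite -autJ_inversion_shift autJ_neq0.
    rewrite subSS -/(P i) mulrCA; congr (_ * _).
    by rewrite -{1}(subnK le_is) exprD exprVn mulrAC mulfV ?mul1r ?expf_neq0.
  apply: smoothn_mul; last exact: smoothn_slash.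
  apply: smoothn_exp; apply: smoothn_add; [exact: smoothn_id | exact: smoothn_cst].
(* The power of 2 pi i passes from X to Y, and [s - i] undoes the reversal. For i > s the truncated
   index is 0, so every member of the family is smooth. *)
exists (fun i z => tpi ^+ i * P (s - i)%N z); split.
  move=> i m; apply: smoothn_mul; first exact: smoothn_cst.
  by apply: sP; rewrite ltnS leq_subr.
move=> gamma det1 z Hz; rewrite QP //; apply: eq_bigr => i _.
have le_is : (i <= s)%N by rewrite -ltnS.
rewrite /= /P subKn // inord_val Y_exp mulrACA -exprMn.
by rewrite mulfV ?two_pi_i_neq0 // expr1n mul1r.
Qed.

Lemma slash_Phi n k s l t f g gamma z : \det gamma = 1 -> H z ->
  slash (k + l + 2 * n) (Phi n k s l t f g) gamma z =
  \sum_(r < n.+1) bracket_coef R[i] n k s l t r *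
    slash (k + 2 * r) (iter r D f) gamma z *
    slash (l + 2 * (n - r)) (iter (n - r) D g) gamma z.
Proof.
move=> det1 Hz; rewrite /slash /Phi mulr_sumr; apply: eq_bigr => r _.
have le_rn : (r <= n)%N by rewrite -ltnS.
have -> : (k + l + 2 * n = (k + 2 * r) + (l + 2 * (n - r)))%N by lia.
rewrite /bracket_coef exprD invfM; ring.
Qed.

Lemma smooth_bracket_component n k s l t (A B : nat -> nat -> C -> C) p :
  (forall i a, smooth (A i a)) -> (forall i a, smooth (B i a)) ->
  smooth (fun z => bracket_component n k s l t (fun i a => A i a z) (fun i a => B i a z) p).
Proof.
move=> sA sB m; apply: smoothn_sum => x; apply: smoothn_sum => x'.
case: (_ == _)%N; last exact: smoothn_cst.
apply: smoothn_mul; first exact: smoothn_cst.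
exact: smoothn_mul (sA _ _ m) (sB _ _ m).
Qed.

End Modular.

Theorem theorem1 (R : realType) (k l s t n : nat)
    (k_gt0 : (0 < k)%N) (l_gt0 : (0 < l)%N)
    (s_le : (s <= k./2)%N) (t_le : (t <= l./2)%N)
    (f g : (R[i]^o)%type -> (R[i]^o)%type)
    (f_qm : quasimodular k s f) (g_qm : quasimodular l t g) :
  quasimodular (k + l + 2 * n) (s + t) (Phi n k s l t f g).
Proof.
case: f_qm => _; rewrite (minn_idPl s_le) => qf /fourier_has_fourier[a fa].
case: g_qm => _; rewrite (minn_idPl t_le) => qg /fourier_has_fourier[b gb].
have [sf sg] := (fourier_smooth fa, fourier_smooth gb).
(* The Fourier expansion of the bracket also yields its holomorphy, through [fourier_D]. *)
have [c Phic] : exists c, has_fourier (Phi n k s l t f g) c.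
  apply: fourier_sum => r.
  have [a' fa'] := fourier_iterD r fa; have [b' gb'] := fourier_iterD (n - r) gb.
  eexists; exact: fourier_mul (fourier_scale _ fa') gb'.
split; [by have [] := fourier_D Phic | | exact: has_fourier_fourier Phic].
(* The cap on the depth is inactive, as s + t is at most half of the total weight. *)
rewrite (minn_idPl _); last by lia.
have lt_sk : (s < k)%N by lia.
have lt_tl : (t < l)%N by lia.
have [Qf [sQf QfP]] := quasi_transform_smooth sf qf.
have [Qg [sQg QgP]] := quasi_transform_smooth sg qg.
pose B z (p : nat) := bracket_component n k s l t
  (fun i a => iter a (@D R) (Qf i) z) (fun i a => iter a (@D R) (Qg i) z) p.
(* The power of 2 pi i converts the coefficient of Y^p into that of X^p. *)
exists (fun p z => (two_pi_i R)^-1 ^+ p * B z p); split.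
  move=> p; apply: smooth_holomorphic => m; apply: smoothn_mul.
    exact: smoothn_cst.
  by apply: smooth_bracket_component => i j; apply: smooth_iterD.
move=> gamma det1 z Hz; rewrite slash_Phi //.
under eq_bigr do rewrite (slash_iterD lt_sk det1 sf sQf (QfP _ det1)) //
  (slash_iterD lt_tl det1 sg sQg (QgP _ det1)) //.
rewrite bracket_depth //; apply: eq_bigr => p _.
by rewrite Y_exp mulrA /B; congr (_ * _); rewrite mulrC.
Qed.
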